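(* Let $\mathcal C\subseteq 2^{[n]}$. The common refinement of the g-matroid subdivisions $\{\Sigma_I : I\in\mathcal C\}$ of the hypercube $[0,1]^n$ is again a g-matroid subdivision if and only if $\mathcal C$ is a weakly separated set in $2^{[n]}$.
   Context: Notation: $[n]=\{1,\dots,n\}$; $A-B$ is set difference; $e_J=\sum_{i\in J}e_i$ for $J\subseteq[n]$. For $k$-subsets $L=\{l_1<\dots<l_k\}$ and $I=\{i_1<\dots<i_k\}$ of $[n]$, write $L\le_G I$ if $l_r\le i_r$ for all $r$. The Schubert matroid $\Omega_I$ is the matroid on $[n]$ whose bases are the $k$-subsets $L$ with $L\le_G I$, $k=|I|$; its rank function is $\theta_I(S)=\max\{|S\cap L| : L\text{ a basis of }\Omega_I\}$. For $f:2^{[n]}\to\mathbb R$, the concave extension $\widehat f:[0,1]^n\to\mathbb R$ is the smallest concave function with $\widehat f(e_J)\ge f(J)$ for all $J$, i.e. $\widehat f(x)=\max\{\sum_J\lambda_Jf(J):\lambda_J\ge0,\sum_J\lambda_J=1,\sum_J\lambda_Je_J=x\}$. Its domains of affinity (projections of the faces of the upper envelope) form a polyhedral subdivision of $[0,1]^n$, called the subdivision induced by $f$. $\Sigma_I$ is the subdivision induced by $\theta_I$. (The common refinement of $\{\Sigma_I\}_{I\in\mathcal C}$ is the subdivision induced by $\sum_{I\in\mathcal C}\widehat\theta_I$.) A generalized polymatroid is a polyhedron all of whose edges are parallel to vectors in $\{\pm e_i,\ e_i-e_j\}$; equivalently, a polyhedron $\{x: g(A)\le\sum_{i\in A}x_i\le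 f(A)\ \forall A\}$ with $f$ submodular, $g$ supermodular, $f(\emptyset)=g(\emptyset)=0$ and $f(B)-f(B-A)\ge g(A)-g(A-B)$ for all $A,B$. A g-matroid (generalized matroid) is a generalized polymatroid whose vertices all lie in $\{0,1\}^n$. A g-matroid subdivision of $[0,1]^n$ is a polyhedral subdivision all of whose cells are g-matroids. Weak separation: write $A\prec B$ if $a<b$ for all $a\in A,b\in B$ (vacuously true if $A$ or $B$ is empty). Sets $A,B\subseteq[n]$ are weakly separated if at least one of the following holds: (i) $|A|\ge|B|$ and $B-A=B'\sqcup B''$ with $B'\prec A-B\prec B''$; (ii) $|B|\ge|A|$ and $A-B=A'\sqcup A''$ with $A'\prec B-A\prec A''$ (the parts may be empty). A collection $\mathcal C\subseteq2^{[n]}$ is a weakly separated set if any two of its elements are weakly separated. *)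

(* Defs.v *)
From HB Require Import structures.
From mathcomp Require Import all_boot all_order all_algebra.
From mathcomp Require Import boolp classical_sets functions cardinality reals.

Set Implicit Arguments.
Unset Strict Implicit.
Unset Printing Implicit Defensive.

Import Order.TTheory GRing.Theory Num.Theory.

Local Open Scope ring_scope.

(* The ground set [n] = {1, ..., n} is represented by 'I_n = {0, ..., n-1}
   with its usual order. *)

Section Combinatorics.
Variable n : nat.
Implicit Types (A B I L S : {set 'I_n}) (C : {set {set 'I_n}}).

(* [enum] lists a subset of 'I_n in increasing order, and [all2] is false on
   sequences of different sizes, so this includes #|L| = #|I|. *)
Definition gale_le L I : bool :=
  all2 (fun l i : 'I_n => (l <= i)%N) (enum L) (enum I).

(* The bases of the Schubert matroid of I are the L with [gale_le L I]. *)
Definition schubert_rank I S : nat :=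
  (\max_(L : {set 'I_n} | gale_le L I) #|S :&: L|)%N.

Definition set_prec A B : Prop := {in A & B, forall a b : 'I_n, (a < b)%N}.

(* [surrounds A B]: A is the disjoint union of A' and A'' (possibly empty)
   with A' < B < A''. *)
Definition surrounds A B : Prop :=
  exists A' A'' : {set 'I_n},
    [/\ A' :|: A'' = A, [disjoint A' & A''], set_prec A' B & set_prec B A''].

Definition weakly_separated A B : Prop :=
  ((#|B| <= #|A|)%N /\ surrounds (B :\: A) (A :\: B)) \/
  ((#|A| <= #|B|)%N /\ surrounds (A :\: B) (B :\: A)).

Definition weakly_separated_set C : Prop :=
  {in C &, forall A B, weakly_separated A B}.

End Combinatorics.

Local Open Scope classical_set_scope.

Section Polyhedra.
Variables (R : realType) (n : nat).
Local Notation V := 'rV[R]_n.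
Implicit Types (P Q F G : set V) (S : set (set V)) (v x : V).

Definition dot (a x : V) : R := \sum_(i < n) a 0 i * x 0 i.

Definition indic (J : {set 'I_n}) : V := \row_i (i \in J)%:R.

Definition cube : set V := [set x | forall i, 0 <= x 0 i <= 1].

Definition argmax_set P (h : V -> R) : set V :=
  [set x | P x /\ forall y, P y -> h y <= h x].

Definition polyhedron P : Prop :=
  exists (m : nat) (a : 'I_m -> V) (b : 'I_m -> R),
    P = [set x | forall k, dot (a k) x <= b k].

(* Nonempty faces only; P itself is one of them (take a = 0). *)
Definition face P F : Prop :=
  F !=set0 /\ exists a : V, F = argmax_set P (dot a).

Definition vertex P v : Prop := face P [set v].

(* F is a one-dimensional face of P, with direction v. *)
Definition edge P F v : Prop :=
  [/\ face P F, v != 0 &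
      exists x, [/\ F x, F (x + v) & forall z, F z -> exists t, z = x + t *: v]].

(* v is parallel to e_i (equivalently -e_i) or to e_i - e_j. *)
Definition gpolymatroid_direction v : Prop :=
  (exists i t, v = t *: delta_mx 0 i) \/
  (exists i j t, i != j /\ v = t *: (delta_mx 0 i - delta_mx 0 j)).

Definition generalized_polymatroid P : Prop :=
  polyhedron P /\ forall F v, edge P F v -> gpolymatroid_direction v.

Definition gmatroid P : Prop :=
  generalized_polymatroid P /\
  forall v, vertex P v -> exists J : {set 'I_n}, v = indic J.

(* A subdivision is given by all its nonempty cells, of every dimension. *)
Record polyhedral_subdivision Q S : Prop := PolyhedralSubdivision {
  subdiv_finite : finite_set S;
  subdiv_cell : forall F, S F -> F !=set0 /\ polyhedron F;
  subdiv_cover : \bigcup_(F in S) F = Q;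
  subdiv_face : forall F G, S F -> face F G -> S G;
  subdiv_inter : forall F G, S F -> S G -> F `&` G !=set0 ->
    face F (F `&` G) /\ face G (F `&` G) }.

Definition gmatroid_subdivision S : Prop :=
  polyhedral_subdivision cube S /\ forall F, S F -> gmatroid F.

(* The supremum is over a nonempty compact set when x lies in the cube, so it
   is a maximum there; the value outside the cube is irrelevant. *)
Definition concave_extension (f : {set 'I_n} -> R) (x : V) : R :=
  sup [set y | exists lam : {set 'I_n} -> R,
    [/\ forall J, 0 <= lam J, \sum_J lam J = 1,
        \sum_J lam J *: indic J = x & \sum_J lam J * f J = y]].

(* The faces of the upper envelope {(x, concave_extension f x) | x in cube}
   are the sets where a linear functional with positive last coordinate,
   normalized to (x, y) |-> y - dot c x, is maximal. *)
Definition induced_subdivision (f : {set 'I_n} -> R) : set (set V) :=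
  [set F | F !=set0 /\ exists c : V,
     F = argmax_set cube (fun x => concave_extension f x - dot c x)].

(* Cells are the nonempty intersections of one cell from each subdivision.
   Including the trivial subdivision of Q, whose cells are the faces of Q,
   changes nothing for a nonempty family of subdivisions of Q, and makes it
   the common refinement of the empty family. *)
Definition common_refinement (T : finType) Q (D : {set T})
    (Sg : T -> set (set V)) : set (set V) :=
  [set F | F !=set0 /\ exists (F0 : set V) (G : T -> set V),
     [/\ face Q F0, forall i, i \in D -> Sg i (G i) &
         F = F0 `&` \bigcap_(i in [set i | i \in D]) G i]].

Definition schubert_subdivision (I : {set 'I_n}) : set (set V) :=
  induced_subdivision (fun J => (schubert_rank I J)%:R).

End Polyhedra.

Arguments cube R n : clear implicits.
Arguments schubert_subdivision R {n} I.

(* Main.v *)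
Require Import Defs.
From mathcomp Require Import all_boot all_order all_algebra.
From mathcomp Require Import boolp classical_sets functions cardinality reals.
From mathcomp Require Import zify ring lra.

(* Write X_a = x_1 + ... + x_a.  On the cube the concave extension of the rank
   function of the Schubert matroid of I is |I| + min_a (X_a - |I \cap [a]|), so
   every cell of a common refinement is cut out by the conditions "these indices
   minimize this function of a", one for each I (the inequalities 0 <= x_i <= 1
   also have this shape).  All constraints bound differences X_b - X_a by
   integers, hence the vertices are 0/1 vectors.

   On an edge, indices that are simultaneous minimizers form classes on which X
   moves rigidly, and there are exactly two classes; the direction is e_i or
   e_i - e_j unless the classes are not an interval and its complement.  In that
   case two pairs of minimizers, of I and of J, cross, and counting elements
   between them shows that I and J are not weakly separated.

   Conversely, if I and J are not weakly separated, a shortest interval in which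
   I - J has more elements than J - I and surrounds one of them yields p < q < r
   and an edge of the refinement with direction e_p - e_q + e_r. *)

Set Implicit Arguments.
Unset Strict Implicit.
Unset Printing Implicit Defensive.

Import Order.TTheory GRing.Theory Num.Theory.

(** * Partial sums of a vector and the pairing [dot] *)

Section PartialSums.
Variables (R : realType) (n : nat).
Local Open Scope ring_scope.
Local Notation V := 'rV[R]_n.
Implicit Types x y : V.

(** Each term of the minimum formula is affine and dominates the rank at 0/1 points, so it bounds
    the concave extension. Equality needs a convex combination of 0/1 points at which one and the
    same term is tight. Rounding all partial sums of x by one random threshold provides it, as
    integer lower bounds on differences of partial sums survive. The same combination stays in every
    cell containing x, which settles the vertices.

    Cells are recorded by forced minimizers instead of inequalities: intersecting cells unites these
    sets, and passing to a face enlarges them.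

    Weak separation lets J - I surround I - J when |J| <= |I|, so an alternation j < i < j' is not
    yet a contradiction; the outer minimizers of a crossing must be compared too. Likewise an
    alternation alone gives no bad edge: the functions of I and J must return to their minima after
    climbing, which is what the two equations of [balanced] say. *)

Definition psum x (a : nat) : R := \sum_(i < n | (i < a)%N) x 0 i.

Lemma psumD x y a : psum (x + y) a = psum x a + psum y a.
Proof. by rewrite -big_split; apply: eq_bigr => i _; rewrite mxE. Qed.

Lemma psumZ t x a : psum (t *: x) a = t * psum x a.
Proof. by rewrite mulr_sumr; apply: eq_bigr => i _; rewrite mxE. Qed.

Lemma psumB x y a : psum (x - y) a = psum x a - psum y a.
Proof. by rewrite -(scaleN1r y) psumD psumZ mulN1r. Qed.

Lemma psum0 x : psum x 0 = 0.
Proof. by rewrite /psum big_pred0. Qed.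

Lemma psumS x (i : 'I_n) : psum x i.+1 = psum x i + x 0 i.
Proof.
rewrite /psum (bigD1 i) //= addrC; congr (_ + _).
by apply: eq_bigl => j; rewrite ltnS [RHS]ltn_neqAle andbC.
Qed.

Lemma psum_sum (T : finType) (f : T -> V) a :
  psum (\sum_t f t) a = \sum_t psum (f t) a.
Proof.
by rewrite /psum exchange_big; apply: eq_bigr => i _; rewrite summxE.
Qed.

Lemma psum_inj x y : (forall a : 'I_n.+1, psum x a = psum y a) -> x = y.
Proof.
move=> exy; apply/rowP => i.
have := exy (lift ord0 i); have := exy (widen_ord (leqnSn n) i).
by rewrite lift0 !psumS /= => -> /addrI.
Qed.

Lemma dotZl t x y : dot (t *: x) y = t * dot x y.
Proof. by rewrite mulr_sumr; apply: eq_bigr => i _; rewrite mxE mulrA. Qed.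

Lemma dotDl x y z : dot (x + y) z = dot x z + dot y z.
Proof. by rewrite -big_split; apply: eq_bigr => i _; rewrite mxE mulrDl. Qed.

Lemma dotC x y : dot x y = dot y x.
Proof. by apply: eq_bigr => i _; rewrite mulrC. Qed.

Lemma dotDr x y z : dot z (x + y) = dot z x + dot z y.
Proof. by rewrite dotC dotDl !(dotC z). Qed.

Lemma dotZr t x y : dot x (t *: y) = t * dot x y.
Proof. by rewrite dotC dotZl dotC. Qed.

Lemma dotBl x y z : dot (x - y) z = dot x z - dot y z.
Proof. by rewrite -scaleN1r dotDl dotZl mulN1r. Qed.

Lemma dotBr x y z : dot z (x - y) = dot z x - dot z y.
Proof. by rewrite dotC dotBl !(dotC z). Qed.

Lemma dot0l x : dot 0 x = 0.
Proof. by rewrite -(scale0r 0) dotZl mul0r. Qed.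

Lemma dot_suml (I : Type) (r : seq I) (P : pred I) (f : I -> V) x :
  dot (\sum_(t <- r | P t) f t) x = \sum_(t <- r | P t) dot (f t) x.
Proof. exact: (big_morph (fun y => dot y x) (fun y z => dotDl y z x) (dot0l x)). Qed.

Definition psum_row (a : nat) : V := \row_i (i < a)%:R.

Lemma dot_psum_row a x : dot (psum_row a) x = psum x a.
Proof.
rewrite /psum big_mkcond; apply: eq_bigr => i _; rewrite mxE.
by case: ifP; rewrite ?mul1r ?mul0r.
Qed.

Lemma dot_delta i x : dot (delta_mx 0 i) x = x 0 i.
Proof.
rewrite /dot (bigD1 i) //= big1 ?addr0 => [|j /negPf ji]; rewrite mxE.
  by rewrite !eqxx mul1r.
by rewrite ji andbF mul0r.
Qed.

Lemma psum_delta (i : 'I_n) a : psum (delta_mx 0 i) a = (i < a)%:R.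
Proof. by rewrite -dot_psum_row dotC dot_delta mxE. Qed.

End PartialSums.

(** * Polyhedra, and faces cut out by tight inequalities *)

Section Polyhedra.
Variables (R : realType) (n : nat).
Local Open Scope ring_scope.
Local Open Scope classical_set_scope.
Local Notation V := 'rV[R]_n.
Implicit Types (P Q F G : set V).

Lemma polyhedron_halfspace (a : V) b : polyhedron [set x | dot a x <= b].
Proof.
exists 1%N, (fun=> a), (fun=> b).
by apply/seteqP; split=> x /= => [? _ //|]; apply; exact: ord0.
Qed.

Lemma polyhedronT : polyhedron [set: V].
Proof.
by exists 0%N, (fun=> 0), (fun=> 0); apply/seteqP; split=> // x _ [].
Qed.

Lemma polyhedron_bigcap (K : finType) (P : K -> set V) :
  (forall k, polyhedron (P k)) -> polyhedron [set x | forall k, P k x].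
Proof.
move=> Ppoly.
have /choice[s Ps] : forall k, exists s : seq (V * R),
    P k = [set x | forall t, t \in s -> dot t.1 x <= t.2].
  move=> k; have [m [a [b ->]]] := Ppoly k.
  exists [seq (a i, b i) | i <- enum 'I_m]; apply/seteqP; split=> x /= le_ab.
    by move=> _ /mapP[i _ ->]; exact: le_ab.
  by move=> i; apply: le_ab (a i, b i) _; apply: map_f; rewrite mem_enum.
pose t0 : V * R := (0, 0); pose S := flatten [seq s k | k <- enum K].
exists (size S), (fun i => (nth t0 S i).1), (fun i => (nth t0 S i).2).
apply/seteqP; split=> x /= Px.
  move=> i; have /flatten_mapP[k _ ks] := mem_nth t0 (ltn_ord i).
  by have := Px k; rewrite Ps; apply.
move=> k; rewrite Ps => t ts.
have tS : t \in S by apply/flatten_mapP; exists k; rewrite ?mem_enum.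
by have := Px (Ordinal (etrans (index_mem t S) tS)); rewrite /= nth_index.
Qed.

(** The sum of the functionals [a t] reaches the sum of the bounds [c t] only where every inequality
    is tight, so this one functional exposes the set. *)
Lemma face_tight (T : finType) (a : T -> V) (c : T -> R) F :
  (forall x, F x -> forall t, dot (a t) x <= c t) ->
  [set x | F x /\ forall t, dot (a t) x = c t] !=set0 ->
  face F [set x | F x /\ forall t, dot (a t) x = c t].
Proof.
move=> Fac [z [Fz tz]]; split; first by exists z.
exists (\sum_t a t); apply/seteqP; split=> x /= [Fx mx]; split=> //.
  by move=> y Fy; rewrite !dot_suml ler_sum // => t _; rewrite mx Fac.
have := mx _ Fz; rewrite !dot_suml => le_zx.
have sle : \sum_t (c t - dot (a t) x) <= 0.
  by rewrite sumrB subr_le0 (le_trans _ le_zx)// ler_sum // => t _; rewrite tz.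
have ge0 s : 0 <= c s - dot (a s) x by rewrite subr_ge0 Fac.
have sum0 : \sum_t (c t - dot (a t) x) = 0.
  by apply/eqP; rewrite eq_le sle sumr_ge0.
move=> t; apply/eqP; rewrite eq_sym -subr_eq0.
by rewrite (psumr_eq0P (fun s _ => ge0 s) sum0 isT).
Qed.

End Polyhedra.

(** * Cells prescribed by sets of minimizing indices *)

Section Cells.
Variables (R : realType) (n : nat) (K : finType).
Local Open Scope ring_scope.
Local Open Scope classical_set_scope.
Local Notation V := 'rV[R]_n.
Variables (W : K -> {set 'I_n.+1}) (w : K -> V).
Implicit Types (x y z d : V) (k : K) (D : {set K}) (M : K -> {set 'I_n.+1}).
Implicit Types (F G : set V).

(** A range [W k] and a shift [w k] cover box constraints as well: with a two-element range,
    prescribing one minimizer is a linear inequality and prescribing both is an equation. *)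
Definition low x k : {set 'I_n.+1} :=
  [set a in W k |
    [forall (b : 'I_n.+1 | b \in W k), psum (x - w k) a <= psum (x - w k) b]].

Lemma lowP x k a :
  reflect (a \in W k /\
    {in W k, forall b : 'I_n.+1, psum (x - w k) a <= psum (x - w k) b})
          (a \in low x k).
Proof. by rewrite inE; apply: (iffP andP) => -[-> /forall_inP]. Qed.

Lemma low_neq0 x k : W k != finset.set0 -> low x k != finset.set0.
Proof.
case/set0Pn => a0 a0W; apply/set0Pn.
case: (Order.TotalTheory.arg_minP (fun a : 'I_n.+1 => psum (x - w k) a) a0W).
by move=> a aW le_a; exists a; apply/lowP.
Qed.

Lemma low_eq x k a b : a \in low x k -> b \in low x k ->
  psum (x - w k) a = psum (x - w k) b.
Proof.
by move=> /lowP[aW lea] /lowP[bW leb]; apply/eqP; rewrite eq_le lea ?leb.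
Qed.

Lemma in_low x k a b : a \in low x k -> b \in W k ->
  psum (x - w k) b <= psum (x - w k) a -> b \in low x k.
Proof.
move=> /lowP[aW lea] bW leba; apply/lowP; split=> // c cW.
exact: le_trans leba (lea _ cW).
Qed.

Definition mid x y : V := 2^-1 *: (x + y).

Lemma psum_mid x y z a :
  psum (mid x y - z) a = (psum (x - z) a + psum (y - z) a) / 2.
Proof. by rewrite !psumB psumZ psumD; field. Qed.

(** Because of the common minimizer m, the minimum at the midpoint is the mean of the two minima,
    and an index reaching it must reach both. *)
Lemma low_mid_sub x y k m : m \in low x k -> m \in low y k ->
  low (mid x y) k \subset low x k :&: low y k.
Proof.
move=> mx my; apply/fintype.subsetP => a /lowP[aW]; rewrite inE.
have [[mW lex] [_ ley]] := (lowP _ _ _ mx, lowP _ _ _ my).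
move/(_ m mW); rewrite !psum_mid.
have := lex a aW; have := ley a aW => hy hx hm.
by rewrite (in_low mx aW) ?(in_low my aW)//; lra.
Qed.

Lemma low_mid_sup x y k : low x k :&: low y k \subset low (mid x y) k.
Proof.
apply/fintype.subsetP => a; rewrite inE => /andP[/lowP[aW lex] /lowP[_ ley]].
apply/lowP; split=> // b bW; rewrite !psum_mid.
by have := lex b bW; have := ley b bW; lra.
Qed.

(* A point of a midpoint-convex set with the fewest minimizers plays the role
   of a point in the relative interior. *)
Lemma low_relint D F : F !=set0 ->
  (forall x y, F x -> F y -> F (mid x y) /\
    {in D, forall k, low (mid x y) k \subset low x k :&: low y k}) ->
  exists2 z, F z & forall y, F y -> {in D, forall k, low z k \subset low y k}.
Proof.
move=> [x0 Fx0] Fmid; pose N x := (\sum_(k in D) #|low x k|)%N.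
have exN : exists m, `[< exists2 x, F x & N x = m >].
  by exists (N x0); apply/asboolP; exists x0.
case: (ex_minnP exN) => m /asboolP[z Fz <-] minz; exists z => // y Fy k kD.
have [Fm lowm] := Fmid _ _ Fz Fy.
have lez : {in D, forall k, low (mid z y) k \subset low z k}.
  by move=> j jD; apply: fintype.subset_trans (lowm j jD) (finset.subsetIl _ _).
have : (#|low z k| <= #|low (mid z y) k|)%N.
  have : (N z <= N (mid z y))%N by apply: minz; apply/asboolP; exists (mid z y).
  rewrite /N (bigD1 k kD) [X in (_ <= X)%N](bigD1 k kD) /=.
  set s := (\sum_(i in D | _) _)%N; set s' := (\sum_(i in D | _) _)%N.
  have : (s' <= s)%N by apply: leq_sum => j /andP[jD _]; rewrite subset_leq_card ?lez.
  by lia.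
rewrite (geq_leqif (subset_leqif_cards (lez k kD))) => /eqP <-.
exact: fintype.subset_trans (lowm k kD) (finset.subsetIr _ _).
Qed.

(** The sum s of the ratios dominates each of them, so [(1 + s)^-1] serves all t at once and is
    positive even when nothing satisfies P. *)
Lemma small_pos (T : finType) (P : pred T) (u v : T -> R) :
  (forall t, P t -> 0 < u t) ->
  exists2 e, 0 < e & forall t, P t -> 0 <= u t + e * v t.
Proof.
move=> u_gt0; pose s := \sum_(t | P t) `|v t| / u t.
have s_ge0 : 0 <= s by apply: sumr_ge0 => t /u_gt0 ut; rewrite divr_ge0 // ltW.
exists (1 + s)^-1 => [|t Pt]; first by rewrite invr_gt0; lra.
have s1_gt0 : 0 < 1 + s by lra.
have le_s : `|v t| / u t <= s.
  rewrite /s (bigD1 t Pt) /= lerDl sumr_ge0 // => j /andP[/u_gt0 uj _].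
  by rewrite divr_ge0 // ltW.
rewrite -(pmulr_rge0 _ s1_gt0) mulrDr mulVKf ?gt_eqF //.
move: le_s; rewrite ler_pdivrMr ?u_gt0 // => le_s.
have := ler_norm (- v t); rewrite normrN.
by have := u_gt0 t Pt; rewrite mulrDl mul1r; lra.
Qed.

Lemma low_perturb D z d :
  {in D, forall k, {in low z k &, forall a b : 'I_n.+1, psum d a = psum d b}} ->
  exists2 e, 0 < e & {in D, forall k, low z k \subset low (z + e *: d) k}.
Proof.
move=> dconst.
pose P (t : K * 'I_n.+1 * 'I_n.+1) := let: (k, a, b) := t in
  [&& k \in D, a \in low z k, b \in W k & b \notin low z k].
pose u (t : K * 'I_n.+1 * 'I_n.+1) := let: (k, a, b) := t in
  psum (z - w k) b - psum (z - w k) a.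
pose v (t : K * 'I_n.+1 * 'I_n.+1) := let: (k, a, b) := t in
  psum d b - psum d a.
have u_gt0 t : P t -> 0 < u t.
  case: t => [[k a] b] /and4P[kD az bW]; rewrite subr_gt0.
  by case: ltP => // /(in_low az bW) ->.
have [e e_gt0 small] := small_pos v u_gt0.
exists e => // k kD; apply/fintype.subsetP => a az; have [aW lea] := lowP _ _ _ az.
apply/lowP; split=> // b bW.
have shift c : psum (z + e *: d - w k) c = psum (z - w k) c + e * psum d c.
  by rewrite !psumB psumD psumZ; ring.
rewrite !shift; have [bz|bz] := boolP (b \in low z k).
  by rewrite (low_eq az bz) (dconst k kD a b).
by have := small (k, a, b); rewrite /P kD az bW bz /= => /(_ isT); lra.
Qed.

Definition cell D M : set V := [set x | {in D, forall k, M k \subset low x k}].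

Definition filled D M := {in D, forall k, M k != finset.set0}.

Lemma cell_mid D M x y : filled D M -> cell D M x -> cell D M y ->
  cell D M (mid x y) /\
  {in D, forall k, low (mid x y) k \subset low x k :&: low y k}.
Proof.
move=> M0 Mx My; split=> k kD.
  by apply: fintype.subset_trans (low_mid_sup x y k); rewrite finset.subsetI Mx ?My.
have /set0Pn[m mM] := M0 k kD.
by apply: (@low_mid_sub _ _ _ m); [apply: fintype.subsetP (Mx k kD) m mM
                              | apply: fintype.subsetP (My k kD) m mM].
Qed.

Lemma face_mid F G x y : face F G -> (F x -> F y -> F (mid x y)) ->
  G x -> G y -> G (mid x y).
Proof.
move=> [_ [a ->]] Fmid [Fx mx] [Fy my]; split; first exact: Fmid.
move=> z Fz; rewrite /mid dotZr dotDr.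
by have := mx z Fz; have := my z Fz; lra.
Qed.

Lemma face_cell_relint D M F : filled D M -> face (cell D M) F ->
  exists2 z, F z & forall y, F y -> {in D, forall k, low z k \subset low y k}.
Proof.
move=> M0 faceF; have [F0 [a Fdef]] := faceF.
have FM x : F x -> cell D M x by rewrite Fdef => -[].
apply: low_relint F0 _ => x y Fx Fy.
have [cm lm] := cell_mid M0 (FM _ Fx) (FM _ Fy); split=> //.
exact: face_mid faceF (fun _ _ => cm) Fx Fy.
Qed.

Lemma cell_low_perturb D M z d : cell D M z ->
  {in D, forall k, {in low z k &, forall a b : 'I_n.+1, psum d a = psum d b}} ->
  exists2 e, 0 < e & cell D M (z + e *: d).
Proof.
move=> Mz /low_perturb[e e0 sub]; exists e => // k kD.
exact: fintype.subset_trans (Mz k kD) (sub k kD).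
Qed.

Lemma low_psumB_const D z y : cell D (low z) y ->
  {in D, forall k, {in low z k &, forall a b : 'I_n.+1, psum (z - y) a = psum (z - y) b}}.
Proof.
move=> zy k kD a b az bz; have sub := fintype.subsetP (zy k kD).
have := low_eq az bz; have := low_eq (sub _ az) (sub _ bz).
by rewrite !psumB; lra.
Qed.

Lemma face_cell D M G : filled D M -> face (cell D M) G ->
  exists z, [/\ G z, G = cell D (low z) & {in D, forall k, M k \subset low z k}].
Proof.
move=> M0 faceG; have [z Gz zmin] := face_cell_relint M0 faceG.
have [_ [a Gdef]] := faceG.
have [Mz mz] : cell D M z /\ forall y, cell D M y -> dot a y <= dot a z.
  by move: Gz; rewrite Gdef => -[].
exists z; split=> //; apply/seteqP; split=> y; first exact: zmin.
move=> zy; rewrite Gdef; split.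
  by move=> k kD; apply: fintype.subset_trans (Mz k kD) (zy k kD).
(* The minimizers of z are minimal at y as well, so z can be pushed a little away from y inside the
   cell. Since z maximizes the functional, the value at y cannot be smaller. *)
have [e e0 /mz] := cell_low_perturb Mz (low_psumB_const zy).
rewrite dotDr dotZr dotBr gerDl pmulr_rle0 // subr_le0 => le_zy t /mz.
by move=> /le_trans; apply.
Qed.

Lemma face_cellI D M M' : filled D M -> cell D M `&` cell D M' !=set0 ->
  {in D, forall k, M' k \subset W k} ->
  face (cell D M) (cell D M `&` cell D M').
Proof.
move=> M0 MM0 M'W.
(* A reference minimizer: another index is minimal iff its value equals the one at [m k]. The
   default is reached only when [M k] is empty, hence for k outside D. *)
pose m k := odflt ord0 [pick a in M k].
have mM k : k \in D -> m k \in M k.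
  by move=> /M0/set0Pn[a aM]; rewrite /m; case: pickP => //= /(_ a); rewrite aM.
pose a (t : K * 'I_n.+1) : V := if (t.1 \in D) && (t.2 \in M' t.1)
  then psum_row R n (m t.1) - psum_row R n t.2 else 0.
pose c (t : K * 'I_n.+1) : R := if (t.1 \in D) && (t.2 \in M' t.1)
  then psum (w t.1) (m t.1) - psum (w t.1) t.2 else 0.
have -> : cell D M `&` cell D M' =
    [set x | cell D M x /\ forall t, dot (a t) x = c t].
  apply/seteqP; split=> x /= [Mx M'x]; split=> //.
    move=> [k b]; rewrite /a /c /=; case: ifP => [/andP[kD bM]|]; last by rewrite dot0l.
    have := low_eq (fintype.subsetP (Mx k kD) _ (mM k kD))
                   (fintype.subsetP (M'x k kD) b bM).
    by rewrite dotBl !dot_psum_row !psumB; lra.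
  move=> k kD; apply/fintype.subsetP => b bM.
  have mx := fintype.subsetP (Mx k kD) _ (mM k kD).
  apply: in_low mx (fintype.subsetP (M'W k kD) b bM) _.
  have := M'x (k, b); rewrite /a /c /= kD bM dotBl !dot_psum_row !psumB /=; lra.
apply: face_tight.
  move=> x Mx [k b]; rewrite /a /c /=.
  case: ifP => [/andP[kD bM]|]; last by rewrite dot0l.
  have /lowP[_ /(_ b)] := fintype.subsetP (Mx k kD) _ (mM k kD).
  rewrite (fintype.subsetP (M'W k kD) b bM) dotBl !dot_psum_row !psumB => /(_ isT).
  by lra.
have [x [Mx M'x]] := MM0; exists x; split=> // -[k b].
rewrite /a /c /=; case: ifP => [/andP[kD bM]|]; last by rewrite dot0l.
have := low_eq (fintype.subsetP (Mx k kD) _ (mM k kD)) (fintype.subsetP (M'x k kD) b bM).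
by rewrite dotBl !dot_psum_row !psumB; lra.
Qed.

Lemma polyhedron_cell D M : {in D, forall k, M k \subset W k} ->
  polyhedron (cell D M).
Proof.
move=> MW; pose P (t : K * 'I_n.+1 * 'I_n.+1) : set V := let: (k, a, b) := t in
  if [&& k \in D, a \in M k & b \in W k]
  then [set x | dot (psum_row R n a - psum_row R n b) x <= psum (w k) a - psum (w k) b]
  else setT.
have -> : cell D M = [set x | forall t, P t x].
  apply/seteqP; split=> x /= Mx.
    move=> [[k a] b]; rewrite /P; case: ifP => //= /and3P[kD aM bW].
    have /lowP[_ /(_ b bW)] := fintype.subsetP (Mx k kD) _ aM.
    by rewrite dotBl !dot_psum_row !psumB; lra.
  move=> k kD; apply/fintype.subsetP => a aM; apply/lowP.
  split=> [|b bW]; first exact: fintype.subsetP (MW k kD) a aM.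
  have := Mx (k, a, b); rewrite /P kD aM bW /= dotBl !dot_psum_row !psumB /=; lra.
apply: polyhedron_bigcap => -[[k a] b]; rewrite /P.
by case: ifP => _; [exact: polyhedron_halfspace | exact: polyhedronT].
Qed.

End Cells.

(** * The rank function of a Schubert matroid as a minimum *)

Section SchubertRank.
Variable n : nat.
Implicit Types (I J L S : {set 'I_n}) (a : nat).

Definition cnt J a : nat := \sum_(i in J) (i < a).

Lemma cntE J a : cnt J a = \sum_(i : 'I_n) (i \in J) * (i < a).
Proof.
by rewrite /cnt big_mkcond; apply: eq_bigr => i _; case: ifP => //; rewrite mul1n.
Qed.

Lemma cardsE_sum J : #|J| = \sum_(i : 'I_n) (i \in J).
Proof. by rewrite -sum1_card big_mkcond; apply: eq_bigr => i _; case: ifP. Qed.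

Lemma cnt0 J : cnt J 0 = 0.
Proof. exact: big1. Qed.

Lemma cnt_full J a : n <= a -> cnt J a = #|J|.
Proof.
move=> na; rewrite -sum1_card; apply: eq_bigr => i _.
by rewrite (leq_trans (ltn_ord i) na).
Qed.

Lemma cnt_enum J a : cnt J a = count (fun i : 'I_n => i < a) (enum J).
Proof.
rewrite /cnt -big_enum -sum1_count [RHS]big_mkcond; apply: eq_bigr => i _.
by case: ifP.
Qed.

(** If the head y of t were below the head x of s, the counts at [y.+1] would be positive for t and
    zero for s. This turns the Gale order into a comparison of counting functions. *)
Lemma all2_leq_count (s t : seq 'I_n) :
  sorted ltn (map val s) -> sorted ltn (map val t) ->
  all2 (fun l i : 'I_n => l <= i) s t <->
  size s = size t /\
    forall a, count (fun i : 'I_n => i < a) t <= count (fun i : 'I_n => i < a) s.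
Proof.
elim: s t => [|x s IHs] [|y t] //= xs yt; [by split=> // -[] | by split=> // -[] |].
have xs_gt z : z \in s -> x < z.
  by move=> zs; apply: (allP (order_path_min ltn_trans xs)); exact: map_f.
have yt_gt z : z \in t -> y < z.
  by move=> zt; apply: (allP (order_path_min ltn_trans yt)); exact: map_f.
have no_small (z : 'I_n) u a : {in u, forall z' : 'I_n, z < z'} -> a <= z.+1 ->
    count (fun i : 'I_n => i < a) u = 0.
  move=> zu az; apply/eqP; rewrite -leqn0 leqNgt -has_count -all_predC.
  by apply/allP => z' /zu zz' /=; lia.
split=> [/andP[xy /IHs[||-> le_ts]]|[[st] le_ts]];
  rewrite ?(path_sorted xs) ?(path_sorted yt) //.
  by split=> // a; have := le_ts a; lia.
have xy : x <= y.
  rewrite leqNgt; apply/negP => yx; have := le_ts y.+1.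
  by rewrite ltnSn (no_small x s) // ?ltnS; lia.
rewrite xy /=; apply/IHs; rewrite ?(path_sorted xs) ?(path_sorted yt) //; split=> // a.
have [ay|ya] := leqP a y.+1; first by rewrite (no_small y t).
by have := le_ts a; lia.
Qed.

Lemma sorted_enum_set J : sorted ltn (map val (enum J)).
Proof.
apply: (subseq_sorted ltn_trans (s2 := map val (enum 'I_n))).
  by apply: map_subseq; rewrite /enum_mem filter_predT filter_subseq.
by rewrite val_enum_ord iota_ltn_sorted.
Qed.

Lemma gale_leP L I :
  gale_le L I <-> #|L| = #|I| /\ forall a, cnt I a <= cnt L a.
Proof.
rewrite /gale_le all2_leq_count ?sorted_enum_set // -!cardE.
by split=> -[-> le_c]; split=> // a; have := le_c a; rewrite !cnt_enum.
Qed.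

Lemma card_cnt_le S L a : #|S :&: L| + cnt L a <= #|L| + cnt S a.
Proof.
rewrite !cntE !cardsE_sum -!big_split /=.
by apply: leq_sum => i _; rewrite inE; case: (i \in S); case: (i \in L); lia.
Qed.

(** A basis has at most [#|I| - cnt I a] elements from a on, and at most [cnt S a] of its elements
    below a lie in S. *)
Lemma schubert_rank_le I S a : schubert_rank I S + cnt I a <= #|I| + cnt S a.
Proof.
have le_I : cnt I a <= #|I|.
  by rewrite -sum1_card; apply: leq_sum => i _; case: (i < a).
suff : schubert_rank I S <= #|I| + cnt S a - cnt I a by lia.
apply/bigmax_leqP => L /gale_leP[cLI le_c].
by have := card_cnt_le S L a; have := le_c a; rewrite cLI; lia.
Qed.

(* If an optimal basis L violated the conclusion for all a, then exchanging the
   largest element of L :\: S for the smallest of S :\: L would give a basis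
   meeting S in one more element. *)
Lemma schubert_rank_attained I S :
  exists a : 'I_n.+1, schubert_rank I S + cnt I a = #|I| + cnt S a.
Proof.
have gII : gale_le I I by apply/gale_leP.
case: (@arg_maxnP _ I (fun L => gale_le L I) (fun L => #|S :&: L|) gII) => L gL /= maxL.
have [cLI le_c] := (gale_leP _ _).1 gL.
have rkE : schubert_rank I S = #|S :&: L|.
  apply/eqP; rewrite eqn_leq; apply/andP; split; first exact/bigmax_leqP.
  exact: (leq_bigmax_cond (F := fun L => #|S :&: L|)).
(* For such an a, L contains S below a and is contained in S from a on, so [S :&: L] has
   [cnt S a + (#|L| - cnt L a)] elements. *)
suff [a [aI below above]] : exists a : 'I_n.+1, [/\ cnt L a = cnt I a,
    forall i, i \in S :\: L -> a <= i & forall i, i \in L :\: S -> i < a].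
  exists a => //; rewrite rkE -aI -cLI !cntE !cardsE_sum -!big_split /=;
  apply: eq_bigr => i _; rewrite inE.
  have := below i; have := above i; rewrite !inE.
  by case: (i \in S); case: (i \in L) => /=; lia.
have [SL0|] := eqVneq (S :\: L) finset.set0.
  exists ord_max; split=> [|i|i _]; last exact: ltn_ord.
    by rewrite !cnt_full.
  by rewrite SL0 inE.
case/set0Pn => s0 s0P.
case: (@arg_minnP _ s0 (fun i => i \in S :\: L) val s0P) => s sP min_s.
have [LS0|] := eqVneq (L :\: S) finset.set0.
  by exists ord0; split=> [|//|i]; rewrite ?cnt0 // LS0 inE.
case/set0Pn => l0 l0P.
case: (@arg_maxnP _ l0 (fun i => i \in L :\: S) val l0P) => l lP max_l.
have [/existsP[a /andP[/andP[la as_] /eqP aI]]|] :=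
    boolP [exists a : 'I_n.+1, (l < a <= s) && (cnt L a == cnt I a)].
  exists a; split=> // i iP; first exact: leq_trans as_ (min_s i iP).
  exact: leq_ltn_trans (max_l i iP) la.
rewrite negb_exists => /forallP noa.
have [[sL sS] [lS lL]] : (s \notin L /\ s \in S) /\ (l \notin S /\ l \in L).
  by move: sP lP; rewrite !inE => /andP[-> ->] /andP[-> ->].
pose L' := s |: L :\ l.
have sumL' (f : 'I_n -> nat) :
    \sum_(i in L') f i + f l = \sum_(i in L) f i + f s.
  rewrite /L' big_setU1 ?inE ?negb_and ?sL ?orbT // (big_setD1 l lL) /=.
  by clear; lia.
(* The exchange lowers [cnt L a] only for l < a <= s, and there [noa] excludes equality with
   [cnt I a]. *)
have gL' : gale_le L' I.
  apply/gale_leP; split=> [|a].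
    have := sumL' (fun=> 1%N); rewrite -!sum1_card in cLI *.
    by clear - cLI; lia.
  have := sumL' (fun i : 'I_n => (i < a) : nat); rewrite -!/(cnt _ _) => cL'.
  have := le_c a; have [la|] := ltnP l a; last by clear - cL'; lia.
  have [sa|as_] := ltnP s a; first by clear - cL' la sa; lia.
  have an : a < n.+1 by have := ltn_ord s; clear - as_; lia.
  have := noa (Ordinal an); rewrite /= la as_ /=.
  by clear - cL' la as_; lia.
have := maxL L' gL'; rewrite !cardsE_sum.
have := sumL' (fun i => (i \in S) : nat).
rewrite sS (negPf lS) !(big_mkcond (fun i => i \in _)) /=.
set A := (X in X + _); set B := (X in _ = X + _) => AB.
have -> : \sum_i (i \in S :&: L') = A.
  by apply: eq_bigr => i _; rewrite !inE; do !case: ifP => //=; case: (i \in S).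
have -> : \sum_i (i \in S :&: L) = B.
  by apply: eq_bigr => i _; rewrite !inE; do !case: ifP => //=; case: (i \in S).
by clear - AB; lia.
Qed.
End SchubertRank.

(** * Rounding points of the cube, and the concave extension *)

Section Decomposition.
Variables (R : realType) (n : nat).
Local Open Scope ring_scope.
Local Open Scope classical_set_scope.
Local Notation V := 'rV[R]_n.
Implicit Types (x : V) (I J : {set 'I_n}).

Lemma psum_indic J a : psum (indic R J) a = (cnt J a)%:R.
Proof.
rewrite /psum cntE natr_sum big_mkcond; apply: eq_bigr => i _; rewrite mxE.
by case: (i \in J); case: ifP.
Qed.

(* A pair [(u, p)] stands for a threshold u of probability p / (1 - u0). *)
Lemma threshold_weights (u0 : R) (s : seq R) : path <=%R u0 s ->
  {in s, forall y : R, y < 1} -> u0 < 1 ->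
  exists L : seq (R * R),
   [/\ {in L, forall t : R * R, [/\ u0 <= t.1, t.1 < 1 & 0 <= t.2]},
       \sum_(t <- L) t.2 = 1 - u0 &
       {in s, forall y : R, \sum_(t <- L) t.2 * (t.1 < y)%R%:R = y - u0}].
Proof.
elim: s u0 => [|y s IHs] u0 /=.
  move=> _ _ u0_lt1; exists [:: (u0, 1 - u0)]; split=> //.
    by move=> t; rewrite inE => /eqP-> /=; split=> //; rewrite ?subr_ge0 ltW.
  by rewrite big_seq1.
case/andP=> u0y ys s_lt1 u0_lt1.
have y_lt1 : y < 1 by apply: s_lt1; rewrite mem_head.
have [z zs|L [Lin Lsum Ls]] := IHs y ys _ y_lt1.
  by apply: s_lt1; rewrite in_cons zs orbT.
exists ((u0, y - u0) :: L); split.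
- move=> t; rewrite in_cons => /predU1P[-> /=|/Lin[]]; first by rewrite subr_ge0.
  by move=> yt t1 t2; rewrite (le_trans u0y yt).
- by rewrite big_cons Lsum /=; ring.
move=> z; rewrite in_cons big_cons /= => /predU1P[->|zs].
  rewrite big_seq big1 ?addr0 => [|t /Lin[yt _ _]].
    case: ltP => [_|yu0]; rewrite ?mulr1 //.
    by apply/eqP; rewrite mulr0 eq_sym subr_eq0; lra.
  by rewrite ltNge yt mulr0.
rewrite Ls //; have yz : y <= z by apply: (allP (order_path_min le_trans ys)).
by case: ltP => [_|zu0]; rewrite ?mulr1 ?mulr0; lra.
Qed.

(** For 0 <= u < 1 this is the ceiling of r - u; it is monotone and commutes with adding integers,
    which is why integer bounds on differences survive. *)
Definition round (u r : R) : int := Num.floor r + (u < r - (Num.floor r)%:~R)%R%:R.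

Lemma round_mono u r s (k : int) : k%:~R <= s - r ->
  k <= round u s - round u r.
Proof.
rewrite /round => krs.
have /andP[r1 r2] := floor_itv r; have /andP[s1 s2] := floor_itv s.
rewrite intrD in r2; rewrite intrD in s2.
have kfs : k + Num.floor r <= Num.floor s.
  by rewrite floor_ge_int intrD; lra.
case: ltP => [_|us]; case: ltP => [ur|_]; rewrite ?mulr1n ?mulr0n; [lia | lia | | lia].
suff : k + Num.floor r + 1 <= Num.floor s by lia.
rewrite lezD1 lt_neqAle kfs andbT; apply/eqP => fsE.
move: us; rewrite leNgt => /negP; apply; rewrite -fsE intrD.
by move: ur; lra.
Qed.

Lemma cube_psumS x (i : 'I_n) : cube R n x ->
  0 <= psum x i.+1 - psum x i <= 1.
Proof. by move=> /(_ i); rewrite psumS; lra. Qed.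

(* Systematic sampling: for a random threshold u, choose i whenever the partial
   sums of x cross an element of u + Z between i and i + 1.  All partial sums
   are then rounded up or down in a monotone, hence order-preserving, way. *)
Lemma cube_decomposition x : cube R n x ->
  exists lam : {set 'I_n} -> R,
  [/\ forall J, 0 <= lam J, \sum_J lam J = 1, \sum_J lam J *: indic R J = x &
   forall J, lam J != 0 -> forall (k : int) (a b : 'I_n.+1),
     k%:~R <= psum x b - psum x a ->
     k%:~R <= psum (indic R J) b - psum (indic R J) a].
Proof.
move=> xQ; pose fr (a : nat) := psum x a - (Num.floor (psum x a))%:~R.
have fr01 a : 0 <= fr a < 1.
  by have /andP[] := floor_itv (psum x a); rewrite intrD /fr => *; apply/andP; lra.
pose s := sort <=%R [seq fr (val a) | a <- enum 'I_n.+1].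
have frs (a : 'I_n.+1) : fr a \in s.
  by rewrite mem_sort; apply: map_f; rewrite mem_enum.
have sP y : y \in s -> 0 <= y < 1 by rewrite mem_sort => /mapP[a _ ->].
have [||//|L [Lin Lsum Ls]] := @threshold_weights 0 s.
- rewrite path_sortedE; last exact: le_trans.
  apply/andP; split; first by apply/allP => y /sP/andP[].
  exact: sort_le_sorted.
- by move=> y /sP/andP[].
pose Ju (u : R) := [set i : 'I_n | round u (psum x i.+1) - round u (psum x i) == 1]%SET.
have psumJ u (a : 'I_n.+1) : 0 <= u ->
    psum (indic R (Ju u)) a = (round u (psum x a))%:~R.
  move=> u0; case: a => a /=; rewrite ltnS; elim: a => [|a IHa] lean.
    by rewrite !psum0 /round floor0 subr0 ltNge u0.
  rewrite (psumS _ (Ordinal lean)) /= IHa ?(ltnW lean) // mxE inE /=.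
  have /andP[x0 x1] := cube_psumS (Ordinal lean) xQ.
  have := @round_mono u (psum x a) (psum x a.+1) 0 x0.
  have : - psum x a.+1 + psum x a >= (-1)%:~R by move: x1 => /=; rewrite intrN; lra.
  rewrite addrC => /(@round_mono u) h1 h2.
  have [eq1|ne1] := eqVneq.
    by have -> : round u (psum x a.+1) = round u (psum x a) + 1; [lia | rewrite intrD].
  have -> : round u (psum x a.+1) = round u (psum x a); last by rewrite addr0.
  by lia.
exists (fun J => \sum_(t <- L | Ju t.1 == J) t.2); split.
- by move=> J; rewrite big_seq_cond sumr_ge0 // => t /andP[/Lin[]].
- rewrite (exchange_big_dep predT) //= -[RHS]subr0 -Lsum; apply: eq_bigr => t _.
  by rewrite (big_pred1 (Ju t.1)) // => J; rewrite /= eq_sym.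
- apply: psum_inj => a; rewrite psum_sum.
  (* The thresholds below [fr a] have total weight [fr a], so the rounded values of [psum x a]
     average to [psum x a]. *)
  transitivity (\sum_(t <- L) t.2 * (round t.1 (psum x a))%:~R).
    under eq_bigr do rewrite psumZ mulr_suml.
    rewrite (exchange_big_dep predT) //= big_seq [RHS]big_seq.
    apply: eq_bigr => t /Lin[t0 _ _]; rewrite -psumJ //.
    by rewrite (big_pred1 (Ju t.1)) // => J; rewrite /= eq_sym.
  under eq_bigr do rewrite intrD mulrDr.
  rewrite big_split /= -mulr_suml Lsum.
  under [X in _ + X]eq_bigr do rewrite mulrz_nat.
  by rewrite Ls ?frs // /fr; ring.
move=> J lamJ k a b kab.
have [t tL /eqP <-] : exists2 t, t \in L & Ju t.1 == J.
  apply/hasP; apply: contraNT lamJ => /hasPn noJ; apply/eqP.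
  by rewrite big_seq_cond big_pred0 // => t; apply/negP => /andP[/noJ/negPf->].
have [t0 _ _] := Lin t tL.
by rewrite !psumJ // -intrB ler_int round_mono.
Qed.

Lemma concave_extension_schubert I x (a : 'I_n.+1) : cube R n x ->
  (forall b : 'I_n.+1, psum (x - indic R I) a <= psum (x - indic R I) b) ->
  concave_extension (fun J => (schubert_rank I J)%:R : R) x =
    #|I|%:R + psum (x - indic R I) a.
Proof.
move=> xQ amin; rewrite /concave_extension; set E := (X in sup X).
have rk_le J (b : 'I_n.+1) : (schubert_rank I J)%:R <=
    #|I|%:R - psum (indic R I) b + psum (indic R J) b.
  have := schubert_rank_le I J b; rewrite -(ler_nat R) !natrD !psum_indic; lra.
have avg lam b : \sum_J lam J = 1 -> \sum_J lam J *: indic R J = x ->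
    \sum_J lam J * (#|I|%:R - psum (indic R I) b + psum (indic R J) b) =
    #|I|%:R + psum (x - indic R I) b.
  move=> lam1 <-; rewrite psumB psum_sum.
  under eq_bigr do rewrite mulrDr; rewrite big_split /= -mulr_suml lam1.
  by under [in RHS]eq_bigr do rewrite psumZ; ring.
have Eub : ubound E (#|I|%:R + psum (x - indic R I) a).
  move=> _ [lam [lam0 lam1 lamx <-]]; rewrite -(avg lam a) //.
  by apply: ler_sum => J _; rewrite ler_wpM2l.
have Ea : E (#|I|%:R + psum (x - indic R I) a).
  have [lam [lam0 lam1 lamx lamJ]] := cube_decomposition xQ.
  exists lam; split=> //; rewrite -(avg lam a) //; apply: eq_bigr => J _.
  have [->|/lamJ JP] := eqVneq (lam J) 0; first by rewrite !mul0r.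
  congr (_ * _); have [b] := schubert_rank_attained I J.
  move/(congr1 (fun m : nat => m%:R : R)); rewrite !natrD -!psum_indic => rkb.
  (* Minimality of a at x bounds [psum x b - psum x a] below by this integer. The bound persists at
     [indic R J], so a does as well there as the index b attaining the rank. *)
  have := JP ((cnt I b)%:R - (cnt I a)%:R) a b.
  rewrite !intrB !mulrz_nat -!psum_indic => JPab.
  have := rk_le J a; have := amin b; rewrite !psumB; lra.
apply/eqP; rewrite eq_le ge_sup //=; last by exists (#|I|%:R + psum (x - indic R I) a).
by apply: ub_le_sup => //; exists (#|I|%:R + psum (x - indic R I) a).
Qed.

End Decomposition.

(** * Cells of the refinement as prescribed minimizers *)

Section SchubertCells.
Variables (R : realType) (n : nat).
Local Open Scope ring_scope.
Local Open Scope classical_set_scope.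
Local Notation V := 'rV[R]_n.
Local Notation K := ('I_n + 'I_n + {set 'I_n})%type.
Implicit Types (x y z d : V) (k : K) (I : {set 'I_n}) (C : {set {set 'I_n}}).
Implicit Types (F G : set V) (M : K -> {set 'I_n.+1}) (i : 'I_n).

Definition lo (i : 'I_n) : 'I_n.+1 := widen_ord (leqnSn n) i.
Definition hi (i : 'I_n) : 'I_n.+1 := lift ord0 i.

(* The three kinds of indices stand for the constraints [0 <= x_i], [x_i <= 1]
   and the minimum of affine functions defining the concave extension of the
   rank function of the Schubert matroid of I. *)
Definition window k : {set 'I_n.+1} :=
  match k with
  | inl (inl i) | inl (inr i) => [set lo i; hi i]%SET
  | inr _ => finset.setT
  end.

Definition offset k : V :=
  match k with
  | inl (inl _) => 0
  | inl (inr i) => delta_mx 0 i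
  | inr J => indic R J
  end.

Definition active C : {set K} :=
  [set k : K | if k is inr J then J \in C else true]%SET.

Local Notation argmin := (low window offset).
Local Notation cellC C M := (cell window offset (active C) M).

(** These memberships impose 0 <= x_i <= 1; the other index of the window, when prescribed too,
    turns the bound into x_i = 0 or x_i = 1. *)
Definition based M := forall i, lo i \in M (inl (inl i)) /\ hi i \in M (inl (inr i)).

Lemma psum_hi x i : psum x (hi i) = psum x (lo i) + x 0 i.
Proof. by rewrite lift0 psumS. Qed.

Lemma argmin_loP x i : (lo i \in argmin x (inl (inl i))) = (0 <= x 0 i).
Proof.
apply/lowP/idP => [[_ /(_ (hi i))]|x_ge0].
  by rewrite /= !inE eqxx orbT !subr0 psum_hi => /(_ isT); lra.
split=> [|b]; rewrite !inE ?eqxx // => /orP[] /eqP->; rewrite !subr0 ?psum_hi; lra.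
Qed.

Lemma psum_delta_lo i : psum (delta_mx 0 i : V) (lo i) = 0.
Proof. by rewrite psum_delta ltnn. Qed.

Lemma psum_delta_hi i : psum (delta_mx 0 i : V) (hi i) = 1.
Proof. by rewrite psum_hi psum_delta_lo add0r mxE !eqxx. Qed.

Lemma argmin_hiP x i : (hi i \in argmin x (inl (inr i))) = (x 0 i <= 1).
Proof.
apply/lowP/idP => [[_ /(_ (lo i))]|x_le1].
  by rewrite /= !inE eqxx !psumB /= psum_hi psum_delta_lo psum_delta_hi => /(_ isT); lra.
split=> [|b]; rewrite !inE ?eqxx ?orbT // => /orP[] /eqP->.
  by rewrite !psumB /= psum_hi psum_delta_lo psum_delta_hi; lra.
by [].
Qed.

Lemma argmin_hi_lower x i : (hi i \in argmin x (inl (inl i))) = (x 0 i <= 0).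
Proof.
apply/lowP/idP => [[_ /(_ (lo i))]|x_le0].
  by rewrite /= !inE eqxx !subr0 psum_hi => /(_ isT); lra.
split=> [|b]; rewrite !inE ?eqxx ?orbT // => /orP[] /eqP->; rewrite !subr0 ?psum_hi; lra.
Qed.

Lemma argmin_lo_upper x i : (lo i \in argmin x (inl (inr i))) = (1 <= x 0 i).
Proof.
apply/lowP/idP => [[_ /(_ (hi i))]|x_ge1].
  rewrite /= !inE eqxx orbT !psumB /= psum_hi psum_delta_lo psum_delta_hi => /(_ isT).
  by lra.
split=> [|b]; rewrite !inE ?eqxx // => /orP[] /eqP->; first by [].
by rewrite !psumB /= psum_hi psum_delta_lo psum_delta_hi; lra.
Qed.

Lemma cube_based x : cube R n x <-> based (argmin x).
Proof.
split=> [xQ i|xb i]; last by have := xb i; rewrite argmin_loP argmin_hiP => -[-> ->].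
by rewrite argmin_loP argmin_hiP; have /andP[-> ->] := xQ i.
Qed.

Lemma argmin_neq0 x k : argmin x k != finset.set0.
Proof.
apply: low_neq0; apply/set0Pn; case: k => [[i|i]|I]; last by exists ord0; rewrite inE.
  by exists (lo i); rewrite !inE eqxx.
by exists (lo i); rewrite !inE eqxx.
Qed.

Lemma cell_cube C M : based M -> cellC C M `<=` cube R n.
Proof.
move=> Mb x Mx; apply/cube_based => i; have [Ml Mh] := Mb i.
split; first by apply: (fintype.subsetP (Mx _ _)) Ml; rewrite inE.
by apply: (fintype.subsetP (Mx _ _)) Mh; rewrite inE.
Qed.

Lemma cell_restrict C C' M x : C \subset C' -> cellC C' M x -> cellC C M x.
Proof.
move=> /fintype.subsetP CC' Mx k; rewrite inE => kC; apply: Mx; rewrite inE.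
by case: k kC => // I /CC'.
Qed.

Lemma cell_setP C M x : cellC C M x <->
  cellC finset.set0 M x /\ {in C, forall I, cellC (finset.set1 I) M x}.
Proof.
split=> [Mx|[M0x MCx] [j|J] kC].
- split=> [|I IC]; apply: cell_restrict Mx; first exact: finset.sub0set.
  by rewrite finset.sub1set.
- by apply: M0x; rewrite inE.
- by apply: (MCx J); move: kC; rewrite !inE.
Qed.

Definition cube_base k : {set 'I_n.+1} :=
  match k with
  | inl (inl i) => finset.set1 (lo i)
  | inl (inr i) => finset.set1 (hi i)
  | inr _ => finset.set0
  end.

Lemma cube_cell : cube R n = cellC finset.set0 cube_base.
Proof.
apply/seteqP; split=> x; last by apply: cell_cube => i; rewrite !inE eqxx.
by move=> /cube_based xb [[i|i]|I]; rewrite !inE //= finset.sub1set; have [] := xb i.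
Qed.

Lemma filled_set0 M : based M -> filled (active finset.set0) M.
Proof.
move=> Mb [[i|i]|I]; rewrite !inE // => _; apply/set0Pn; have [? ?] := Mb i.
  by exists (lo i).
by exists (hi i).
Qed.

Lemma based_cube_base : based cube_base.
Proof. by move=> i; rewrite !inE eqxx. Qed.

Lemma cell_sub_window C M : cellC C M !=set0 ->
  {in active C, forall k, M k \subset window k}.
Proof.
move=> [x Mx] k kC; apply: fintype.subset_trans (Mx k kC) _.
by apply/fintype.subsetP => a /lowP[].
Qed.

Lemma face_cubeP F : face (cube R n) F <->
  F !=set0 /\ exists2 M, based M & F = cellC finset.set0 M.
Proof.
split=> [fF|[F0 [M Mb FE]]].
  split; first by case: fF.
  move: fF; rewrite cube_cell => /(face_cell (filled_set0 based_cube_base)).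
  move=> [z [Fz -> zmin]]; exists (argmin z) => //; apply/cube_based.
  by rewrite cube_cell => k /zmin.
have FQ : F = cube R n `&` F.
  by apply/esym/setIidPr; rewrite FE; exact: cell_cube.
rewrite FQ FE cube_cell; apply: face_cellI.
- exact: filled_set0 based_cube_base.
- by rewrite -cube_cell -FE -FQ.
- by apply: cell_sub_window; rewrite -FE.
Qed.

Local Notation ext I x :=
  (concave_extension (fun J => (schubert_rank I J)%:R : R) x).

Lemma extE I x a : cube R n x -> a \in argmin x (inr I) ->
  ext I x = #|I|%:R + psum (x - indic R I) a.
Proof.
move=> xQ /lowP[_ amin]; apply: concave_extension_schubert => // b.
by apply: amin; rewrite inE.
Qed.

Lemma ext_le I x (a : 'I_n.+1) : cube R n x ->
  ext I x <= #|I|%:R + psum (x - indic R I) a.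
Proof.
move=> xQ; have /set0Pn[b bx] := argmin_neq0 x (inr I).
rewrite (extE xQ bx) lerD2l; have /lowP[_ -> //] := bx.
by rewrite inE.
Qed.

Lemma ext_tight I x (a : 'I_n.+1) : cube R n x ->
  ext I x = #|I|%:R + psum (x - indic R I) a -> a \in argmin x (inr I).
Proof.
move=> xQ; have /set0Pn[b bx] := argmin_neq0 x (inr I).
rewrite (extE xQ bx) => /addrI eba; apply: in_low bx _ _; first by rewrite inE.
by rewrite [X in _ <= X]eba.
Qed.

(** By concavity, maximizers x and y of the exposing function force equality at their midpoint,
    where each minimizing index must be minimal at both ends. A point z with fewest minimizers then
    determines F: the extension is affine on the cell of [argmin z], and pushing z away from y shows
    that y is a maximizer too. *)
Lemma schubert_subdivision_cell I F : schubert_subdivision R I F ->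
  F !=set0 /\ exists M, [/\ filled (active (finset.set1 I)) M, based M &
                          F = cellC (finset.set1 I) M].
Proof.
move=> [F0 [c Fdef]]; split=> //.
have FQ x : F x -> cube R n x by rewrite Fdef => -[].
have Fmax x y : F x -> cube R n y -> ext I y - dot c y <= ext I x - dot c x.
  by rewrite Fdef => -[_ mx] /mx.
have inF x y : F x -> cube R n y -> ext I x - dot c x <= ext I y - dot c y -> F y.
  move=> Fx yQ le_xy; rewrite Fdef; split=> // p pQ.
  by apply: le_trans le_xy; exact: Fmax.
clear Fdef; have [z Fz zmin] : exists2 z, F z & forall y, F y ->
    {in active (finset.set1 I), forall k, argmin z k \subset argmin y k}.
  apply: low_relint => // x y Fx Fy; have [xQ yQ] := (FQ _ Fx, FQ _ Fy).
  have [mQ sub0] : cube R n (mid x y) /\ {in active finset.set0, forall k,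
      argmin (mid x y) k \subset argmin x k :&: argmin y k}.
    move: xQ yQ; rewrite cube_cell; apply: cell_mid.
    exact: filled_set0 based_cube_base.
  have dotm : dot c (mid x y) = (dot c x + dot c y) / 2.
    by rewrite dotZr dotDr mulrC.
  have extm a : a \in argmin (mid x y) (inr I) ->
      [/\ ext I x - dot c x <= ext I (mid x y) - dot c (mid x y),
          a \in argmin x (inr I) & a \in argmin y (inr I)].
    move=> am; have := extE mQ am; rewrite psum_mid => em.
    have := Fmax _ _ Fx mQ; have := Fmax _ _ Fy mQ; have := Fmax _ _ Fx yQ.
    have := Fmax _ _ Fy xQ; have := ext_le I a xQ; have := ext_le I a yQ.
    by split; [|apply: ext_tight => //|apply: ext_tight => //]; lra.
  split.
    have /set0Pn[a am] := argmin_neq0 (mid x y) (inr I).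
    by have [le_m _ _] := extm a am; exact: inF le_m.
  move=> [j|J]; rewrite !inE => kI; first by apply: sub0; rewrite inE.
  rewrite (eqP kI); apply/fintype.subsetP => a /extm[_ ax ay].
  by rewrite inE ax.
exists (argmin z); have zb := (cube_based z).1 (FQ _ Fz); split=> //.
  by move=> k _; exact: argmin_neq0.
apply/seteqP; split=> y; first exact: zmin.
move=> zy; have yQ := cell_cube zb zy.
have zz : cellC (finset.set1 I) (argmin z) z by [].
have [e e0 zp] := cell_low_perturb zz (low_psumB_const zy).
have pQ := cell_cube zb zp.
have /set0Pn[a az] := argmin_neq0 z (inr I).
have IC : inr I \in active (finset.set1 I) by rewrite !inE.
have := Fmax _ _ Fz pQ.
rewrite (extE pQ (fintype.subsetP (zp _ IC) a az)) (extE (FQ _ Fz) az).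
rewrite !psumB psumD psumZ psumB dotDr dotZr dotBr => le_pz.
apply: (inF _ _ Fz yQ).
rewrite (extE yQ (fintype.subsetP (zy _ IC) a az)) (extE (FQ _ Fz) az) !psumB.
have : e * ((psum z a - dot c z) - (psum y a - dot c y)) <= 0 by lra.
by rewrite pmulr_rle0 //; lra.
Qed.

Lemma cell_schubert_subdivision I M :
  filled (active (finset.set1 I)) M -> based M ->
  cellC (finset.set1 I) M !=set0 ->
  schubert_subdivision R I (cellC (finset.set1 I) M).
Proof.
move=> M0 Mb [x0 Mx0]; split; first by exists x0.
have IC : inr I \in active (finset.set1 I) by rewrite !inE.
pose MI := M (inr I); pose N : R := #|MI|%:R.
have N_gt0 : 0 < N by rewrite ltr0n card_gt0 (M0 _ IC).
pose Z i := hi i \in M (inl (inl i)); pose O i := lo i \in M (inl (inr i)).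
(* The factor [N^-1] averages the affine terms prescribed by MI, so that the extension minus [dot c]
   is a constant minus h, where h combines slacks that are nonnegative on the cube. The signs
   penalize x_i > 0 for Z and x_i < 1 for O. *)
pose c : V := N^-1 *: (\sum_(a in MI) psum_row R n (a : 'I_n.+1)) +
  \sum_(i | Z i) delta_mx 0 i - \sum_(i | O i) delta_mx 0 i.
pose h x := N^-1 * (\sum_(a in MI) (#|I|%:R + psum (x - indic R I) a - ext I x)) +
  \sum_(i | Z i) x 0 i + \sum_(i | O i) (1 - x 0 i).
pose kap : R := N^-1 * (\sum_(a in MI) (#|I|%:R - psum (indic R I) (a : 'I_n.+1))) +
  \sum_(i | O i) 1.
have hE x : ext I x - dot c x = kap - h x.
  rewrite /h /kap /c dotBl dotDl dotZl !dot_suml.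
  under eq_bigr do rewrite dot_psum_row.
  under [X in _ + X - _]eq_bigr do rewrite dot_delta.
  under [X in _ - X]eq_bigr do rewrite dot_delta.
  have -> : \sum_(a in MI) (#|I|%:R + psum (x - indic R I) a - ext I x) =
      \sum_(a in MI) (#|I|%:R - psum (indic R I) a) + \sum_(a in MI) psum x a
      - N * ext I x.
    rewrite sumrB sumr_const -(mulr_natl _ #|MI|) -big_split; congr (_ - _).
    by apply: eq_bigr => a _; rewrite psumB /=; ring.
  rewrite [\sum_(i | O i) (1 - _)]sumrB.
  by field; rewrite gt_eqF.
have h_ge0 x : cube R n x -> [/\ 0 <= h x,
    forall a, a \in MI -> 0 <= #|I|%:R + psum (x - indic R I) a - ext I x,
    forall i, 0 <= x 0 i & forall i, 0 <= 1 - x 0 i].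
  move=> xQ; have t1 a : a \in MI -> 0 <= #|I|%:R + psum (x - indic R I) a - ext I x.
    by move=> _; rewrite subr_ge0 ext_le.
  have t2 i : 0 <= x 0 i by have /andP[] := xQ i.
  have t3 i : 0 <= 1 - x 0 i by have /andP[] := xQ i; rewrite subr_ge0.
  split=> //; rewrite !addr_ge0 ?sumr_ge0 // mulr_ge0 ?invr_ge0 ?(ltW N_gt0) //.
  exact: sumr_ge0.
have FE x : cellC (finset.set1 I) M x <-> cube R n x /\ h x = 0.
  split=> [Mx|[xQ]].
    have xQ := cell_cube Mb Mx; split=> //; rewrite /h !big1 ?mulr0 ?addr0 //.
    - move=> i Oi; apply/eqP; rewrite subr_eq0 eq_le; have /andP[_ ->] := xQ i.
      rewrite andbT -argmin_lo_upper.
      by apply: (fintype.subsetP (Mx _ _)) Oi; rewrite inE.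
    - move=> i Zi; apply/eqP; rewrite eq_le andbC; have /andP[-> _] := xQ i.
      by rewrite /= -argmin_hi_lower; apply: (fintype.subsetP (Mx _ _)) Zi; rewrite inE.
    move=> a aM; apply/eqP; rewrite subr_eq0.
    by rewrite (extE xQ (fintype.subsetP (Mx _ IC) a aM)).
  have [h0 t1 t2 t3] := h_ge0 x xQ.
  have s1 : 0 <= \sum_(a in MI) (#|I|%:R + psum (x - indic R I) a - ext I x).
    exact: sumr_ge0.
  have s2 : 0 <= \sum_(i | Z i) x 0 i by exact: sumr_ge0.
  have s3 : 0 <= \sum_(i | O i) (1 - x 0 i) by exact: sumr_ge0.
  move=> /eqP; rewrite /h paddr_eq0 ?addr_ge0 ?mulr_ge0 ?invr_ge0 ?(ltW N_gt0) //.
  rewrite paddr_eq0 ?mulr_ge0 ?invr_ge0 ?(ltW N_gt0) // mulf_eq0 invr_eq0 gt_eqF //=.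
  move=> /andP[/andP[/eqP e1 /eqP e2] /eqP e3].
  have := (cube_based x).1 xQ => xb.
  move=> [[i|i]|J] kC.
  - have [l_x _] := xb i; apply/fintype.subsetP => a aM.
    have := fintype.subsetP (cell_sub_window (ex_intro _ _ Mx0) kC) a aM.
    case/set2P => ea; first by rewrite ea.
    have Zi : Z i by rewrite /Z -ea.
    by rewrite ea argmin_hi_lower (psumr_eq0P (fun j _ => t2 j) e2 Zi).
  - have [_ h_x] := xb i; apply/fintype.subsetP => a aM.
    have := fintype.subsetP (cell_sub_window (ex_intro _ _ Mx0) kC) a aM.
    case/set2P => ea; last by rewrite ea.
    have Oi : O i by rewrite /O -ea.
    by rewrite ea argmin_lo_upper -subr_le0 (psumr_eq0P (fun j _ => t3 j) e3 Oi).
  move: kC; rewrite !inE => /eqP->; apply/fintype.subsetP => a aM.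
  apply: ext_tight => //; apply/eqP; rewrite eq_sym -subr_eq0; apply/eqP.
  exact: psumr_eq0P t1 e1 _ aM.
exists c; apply/seteqP; split=> x.
  move=> /FE[xQ hx]; split=> // y yQ; rewrite !hE hx.
  by have [] := h_ge0 y yQ; lra.
move=> [xQ mx]; apply/FE; split=> //; have [x0Q hx0] := (FE x0).1 Mx0.
have := mx x0 x0Q; rewrite !hE hx0; have [] := h_ge0 x xQ.
by move=> hx _ _ _ hx'; apply/eqP; rewrite eq_le hx andbT; lra.
Qed.

Local Notation refinement C :=
  (common_refinement (cube R n) C (schubert_subdivision R)).

Lemma refinementP C F : refinement C F <->
  F !=set0 /\ exists M, [/\ filled (active C) M, based M & F = cellC C M].
Proof.
split=> [[F0 [Q0 [G [/face_cubeP[_ [M0 M0b Q0E]] GP FE]]]]|].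
  split=> //; have /choice[M MP] : forall J, exists M, J \in C ->
      [/\ filled (active (finset.set1 J)) M, based M &
        G J = cellC (finset.set1 J) M].
    move=> J.
    have [JC|] := boolP (J \in C); last by exists M0.
    by have [_ [M MP]] := schubert_subdivision_cell (GP J JC); exists M.
  (* Each Schubert cell carries its own cube constraints, so the sets at [inl j] are united over all
     cells; [inr J] is governed by the cell of J only. *)
  pose N k := match k with
    | inl j => M0 k :|: \bigcup_(J in C) M J k | inr J => M J k end%SET.
  have Nb : based N by move=> i; have [l h] := M0b i; rewrite !inE l h.
  exists N; split=> //.
    move=> [[i|i]|J]; rewrite inE => kC; last first.
    - by have [/(_ (inr J)) + _ _] := MP J kC; apply; rewrite !inE.
    - by apply/set0Pn; exists (hi i); have [] := Nb i.
    by apply/set0Pn; exists (lo i); have [] := Nb i.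
  rewrite FE Q0E; apply/seteqP; split=> x.
    move=> [Qx Gx]; move=> [j|J] kC.
      rewrite /N finset.subUset (Qx (inl j)) ?inE //=; apply/bigcupsP => J JC.
      have := Gx J JC; have [_ _ ->] := MP J JC; apply.
      by rewrite inE.
    move: kC; rewrite inE => JC; have := Gx J JC; have [_ _ ->] := MP J JC; apply.
    by rewrite !inE.
  move=> Nx; have Nx_inl j : N (inl j) \subset argmin x (inl j).
    by apply: Nx; rewrite inE.
  split=> [[j|J]|J /= JC]; rewrite ?inE //.
    by move=> _; have := Nx_inl j; rewrite finset.subUset => /andP[].
  have [_ _ ->] := MP J JC; move=> [j _|J']; last first.
    by rewrite !inE => /eqP->; apply: (Nx (inr J)); rewrite inE.
  by have := Nx_inl j; rewrite finset.subUset => /andP[_ /bigcupsP]; apply.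
move=> [F0 [M [Mf Mb FE]]]; split=> //.
exists (cellC finset.set0 M), (fun J => cellC (finset.set1 J) M); split.
- apply/face_cubeP; split; last by exists M.
  by have [x] := F0; rewrite FE => /cell_setP[Mx _]; exists x.
- move=> J JC; apply: cell_schubert_subdivision => //.
    move=> k; rewrite inE => kJ; apply: Mf; rewrite inE.
    by case: k kJ => // J'; rewrite inE => /eqP->.
  by have [x] := F0; rewrite FE => /cell_setP[_ /(_ J JC) Mx]; exists x.
rewrite FE; apply/seteqP; split=> x; first by move=> /cell_setP[].
by move=> [Mx MCx]; apply/cell_setP; split=> // J JC; exact: MCx.
Qed.

Lemma refinement_subdivision C : polyhedral_subdivision (cube R n) (refinement C).
Proof.
split.
- apply: (@sub_finite_set _ _ (range (fun M : {ffun K -> {set 'I_n.+1}} => cellC C M))).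
    move=> F /refinementP[_ [M [_ _ ->]]]; exists (finfun M) => //.
    by apply/seteqP; split=> x Mx k kC; have := Mx k kC; rewrite ffunE.
  exact/finite_image/finite_finset.
- move=> F /refinementP[F0 [M [_ _ FE]]]; split=> //.
  by rewrite FE; apply: polyhedron_cell; apply: cell_sub_window; rewrite -FE.
- apply/seteqP; split=> x.
    by move=> [F /refinementP[_ [M [_ Mb ->]]]]; exact: cell_cube.
  move=> /cube_based xb; exists (cellC C (argmin x)) => //.
  apply/refinementP; split; first by exists x.
  by exists (argmin x); split=> // k _; exact: argmin_neq0.
- move=> F G /refinementP[F0 [M [Mf Mb ->]]] /(face_cell Mf)[z [Gz -> zmin]].
  apply/refinementP; split; first by exists z.
  exists (argmin z); split=> //; first by move=> k _; exact: argmin_neq0.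
  move=> i; have [l h] := Mb i.
  by split; [apply: fintype.subsetP l | apply: fintype.subsetP h];
     apply: zmin; rewrite inE.
move=> F G /refinementP[F0 [M [Mf _ FE]]] /refinementP[G0 [N [Nf _ GE]]] FG0.
split; last rewrite setIC; rewrite FE GE; apply: face_cellI => //.
- by rewrite -FE -GE.
- by apply: cell_sub_window; rewrite -GE.
- by rewrite setIC -FE -GE.
- by apply: cell_sub_window; rewrite -FE.
Qed.

End SchubertCells.

(** * From weak separation to edge directions and 0/1 vertices *)

Lemma cnt_lt_ex n (I J : {set 'I_n}) a b : a <= b ->
  cnt I b + cnt J a < cnt J b + cnt I a ->
  exists2 i : 'I_n, i \in J :\: I & a <= i < b.
Proof.
move=> ab lt_IJ; apply/exists_inP; apply: contraLR lt_IJ.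
rewrite negb_exists_in => /forall_inP noi; rewrite -leqNgt !cntE -!big_split /=.
apply: leq_sum => i _; have := noi i; rewrite inE.
by case: (i \in J); case: (i \in I) => /=; lia.
Qed.

Lemma connect_exit (T : finType) (e : rel T) (P : pred T) x y :
  connect e x y -> P x -> ~~ P y ->
  exists p q, [/\ connect e x p, P p, ~~ P q & e p q].
Proof.
case/connectP => s; elim: s x => [|z s IHs] x /=.
  by move=> _ -> Px /negP.
case/andP=> xz zs ys Px Py; have [Pz|Pz] := boolP (P z).
  have [p [q [zp Pp Pq pq]]] := IHs z zs ys Pz Py.
  by exists p, q; split=> //; apply: connect_trans zp; exact: connect1.
by exists x, z.
Qed.

(** The alternation leaves only the case where J - I surrounds I - J. Then I - J has no element left
    of j1 or right of j2, which compares the counts before a and from b' on. *)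
Lemma weakly_separated_alternating n (I J : {set 'I_n}) (j1 i1 j2 : 'I_n) :
  j1 \in J :\: I -> i1 \in I :\: J -> j2 \in J :\: I -> weakly_separated I J ->
  forall a b', a <= j1 < i1 /\ i1 < j2 < b' /\ b' <= n ->
  [/\ #|J| <= #|I|, cnt I a <= cnt J a & #|I| + cnt J b' <= #|J| + cnt I b'].
Proof.
move=> j1JI i1IJ j2JI + a b' [/andP[aj1 j1i1] [/andP[i1j2 j2b'] b'n]].
move=> [[leJI]|[_]] [S1 [S2 [/setP defS _ S1_lt S2_gt]]]; last first.
  have := defS i1; rewrite i1IJ inE => /orP[i1S|i1S].
    by have := S1_lt _ _ i1S j1JI; lia.
  by have := S2_gt _ _ j2JI i1S; lia.
have inS j : j \in J :\: I -> j \in S1 \/ j \in S2.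
  by move=> jJI; have := defS j; rewrite jJI inE => /orP.
have lo_le : (cnt I a <= cnt J a)%N.
  rewrite leqNgt; apply/negP => lt_a.
  have [|i0 i0IJ /andP[_ i0a]] := @cnt_lt_ex n J I 0 a (leq0n a).
    by rewrite !cnt0; lia.
  have [j1S|j1S] := inS _ j1JI; first by have := S1_lt _ _ j1S i0IJ; lia.
  by have := S2_gt _ _ i1IJ j1S; lia.
have hi_le : (#|I| + cnt J b' <= #|J| + cnt I b')%N.
  rewrite leqNgt; apply/negP => lt_b'.
  have [|i0 i0IJ /andP[b'i0 _]] := @cnt_lt_ex n J I b' n b'n.
    by rewrite !(cnt_full _ (leqnn n)).
  have [j2S|j2S] := inS _ j2JI; first by have := S1_lt _ _ j2S i1IJ; lia.
  by have := S2_gt _ _ i0IJ j2S; lia.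
by [].
Qed.

Section WeaklySeparatedCells.
Variables (R : realType) (n : nat).
Local Open Scope ring_scope.
Local Open Scope classical_set_scope.
Local Notation V := 'rV[R]_n.
Local Notation K := ('I_n + 'I_n + {set 'I_n})%type.
Local Notation argmin := (low (@window n) (@offset R n)).
Local Notation cellC C M := (cell (@window n) (@offset R n) (active C) M).
Implicit Types (x y z d v : V) (k : K) (I J : {set 'I_n}) (C : {set {set 'I_n}}).
Implicit Types (F G : set V) (M : K -> {set 'I_n.+1}) (a b : 'I_n.+1).

Lemma argmin_le x I a b : a \in argmin x (inr I) ->
  psum x a - (cnt I a)%:R <= psum x b - (cnt I b)%:R.
Proof.
by move=> /lowP[_ /(_ b)]; rewrite inE !psumB !psum_indic; apply.
Qed.

Lemma argmin_lt x I a b : a \in argmin x (inr I) -> b \notin argmin x (inr I) ->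
  psum x a - (cnt I a)%:R < psum x b - (cnt I b)%:R.
Proof.
move=> ax; apply: contraNT; rewrite -leNgt => le_ba.
by apply: in_low ax _ _; rewrite ?inE // !psumB !psum_indic.
Qed.

(** Comparing values of the two functions, J has more elements than I in [a, b[ and in [a', b'[, and
    fewer in [b, a'[, so the sets alternate. The outer pair a, b' gives J more elements in [a, b'[
    as well; weak separation allows no compensation outside, whence |I| < |J|, against the size
    condition. *)
Lemma crossing_not_separated x I J a b a' b' : (a < b < a')%N -> (a' < b')%N ->
  a \in argmin x (inr I) -> a' \in argmin x (inr I) ->
  b \notin argmin x (inr I) -> b' \notin argmin x (inr I) ->
  b \in argmin x (inr J) -> b' \in argmin x (inr J) ->
  a \notin argmin x (inr J) -> a' \notin argmin x (inr J) ->
  ~ weakly_separated I J.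
Proof.
move=> /andP[ab ba'] a'b' aI a'I bI b'I bJ b'J aJ a'J.
have Iab := argmin_lt aI bI; have Ia'b' := argmin_lt a'I b'I.
have Iaa' := argmin_le a' aI; have Ia'a := argmin_le a a'I.
have Jbb' := argmin_le b' bJ; have Jb'b := argmin_le b b'J.
have Jba := argmin_lt bJ aJ; have Jb'a' := argmin_lt b'J a'J.
have Ia'b := argmin_lt a'I bI; have Jba' := argmin_lt bJ a'J.
have [||j1 j1JI /andP[aj1 j1b]] := @cnt_lt_ex n I J a b; first exact: ltnW.
  by rewrite -(ltr_nat R) !natrD; lra.
have [||i1 i1IJ /andP[bi1 i1a']] := @cnt_lt_ex n J I b a'; first exact: ltnW.
  by rewrite -(ltr_nat R) !natrD; lra.
have [||j2 j2JI /andP[a'j2 j2b']] := @cnt_lt_ex n I J a' b'; first exact: ltnW.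
  by rewrite -(ltr_nat R) !natrD; lra.
move=> /(weakly_separated_alternating j1JI i1IJ j2JI) sepIJ.
have [|leJI lo_le hi_le] := sepIJ a b'.
  rewrite aj1 (leq_trans j1b bi1) (leq_trans i1a' a'j2) j2b'.
  by split=> //; split=> //; exact: ltn_ord b'.
by move: leJI lo_le hi_le; rewrite -!(ler_nat R) !natrD; lra.
Qed.

Definition linked C z : rel 'I_n.+1 :=
  fun a b => [exists k in active C, (a \in argmin z k) && (b \in argmin z k)].

Lemma linkedP C z a b :
  reflect (exists k, [/\ k \in active C, a \in argmin z k & b \in argmin z k])
          (linked C z a b).
Proof.
apply: (iffP exists_inP) => [[k kC /andP[ak bk]]|[k [kC ak bk]]]; exists k => //.
by rewrite ak.
Qed.

Lemma linked_connect_sym C z : connect_sym (linked C z).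
Proof.
by apply: sym_connect_sym => a b; apply/linkedP/linkedP => -[k [*]]; exists k.
Qed.

Lemma argmin_inl z a b j : a \in argmin z (inl j) -> b \in argmin z (inl j) ->
  (b <= a.+1)%N.
Proof.
move=> /lowP[+ _] /lowP[+ _].
by case: j => i /set2P[]-> /set2P[]->; rewrite ?lift0 /=; lia.
Qed.

(* Links of the class of s and of the class of 0 are arcs in the upper half
   plane; if t lies between s and s', then two of these arcs cross. *)
Lemma linked_class_convex C z (s t s' : 'I_n.+1) : weakly_separated_set C ->
  (s < t < s')%N -> connect (linked C z) s s' -> connect (linked C z) ord0 t ->
  connect (linked C z) s t.
Proof.
move=> ws /andP[st ts'] ss' t0; apply: contraT => Nst; exfalso.
have csym := linked_connect_sym C z.
have [|p [q [sp pt qt pq]]] := connect_exit (P := fun a : 'I_n.+1 => (a < t)%N) ss' st.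
  by rewrite -leqNgt ltnW.
have sq : connect (linked C z) s q := connect_trans sp (connect1 pq).
have {qt} tq : (t < q)%N.
  rewrite -leqNgt in qt; rewrite ltn_neqAle qt andbT; apply: contra Nst.
  by move=> /eqP/val_inj ->.
have t0' : connect (linked C z) t ord0 by rewrite csym.
(* The class of t contains [ord0], which is not strictly between p and q, so some link of this class
   leaves that interval. *)
have [||b [b' [tb bpq b'pq bb']]] :=
    connect_exit (P := fun a : 'I_n.+1 => (p < a < q)%N) t0'.
- by rewrite pt.
- by [].
have tb' : connect (linked C z) t b' := connect_trans tb (connect1 bb').
have sep c c' : connect (linked C z) s c -> connect (linked C z) t c' ->
    ~~ linked C z c c'.
  move=> sc tc'; apply: contra Nst => cc'; apply: connect_trans sc _.
  by apply: connect_trans (connect1 cc') _; rewrite csym.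
have neq c c' : connect (linked C z) s c -> connect (linked C z) t c' -> (c : nat) <> c'.
  move=> sc tc' /val_inj cc'; case/negP: Nst; apply: connect_trans sc _.
  by rewrite cc' csym.
have pb' := neq _ _ sp tb'; have qb' := neq _ _ sq tb'.
(* A cube window links only consecutive indices, and such an arc crosses nothing; so both links come
   from members of C. *)
have /linkedP[[j|I] [kC pI qI]] := pq.
  by have := leq_ltn_trans pt tq; rewrite ltnNge (argmin_inl pI qI).
have /linkedP[[j|J] [kC' bJ b'J]] := bb'.
  have := argmin_inl bJ b'J; have := argmin_inl b'J bJ.
  by clear - bpq b'pq pb' qb'; lia.
have notin_I c : connect (linked C z) t c -> c \notin argmin z (inr I).
  by move=> tc; apply: contra (sep _ _ sp tc) => cI; apply/linkedP; exists (inr I).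
have notin_J c : connect (linked C z) s c -> c \notin argmin z (inr J).
  by move=> sc; apply: contra (sep _ _ sc tb) => cJ; apply/linkedP; exists (inr J).
rewrite !inE in kC kC'.
have [qb|bq] := ltnP q b'.
  by apply: (@crossing_not_separated z I J p b q b') (ws _ _ kC kC');
     rewrite ?notin_I ?notin_J.
have b'p : (b' < p)%N by clear - b'pq pb' qb' bq; lia.
have [pb bq'] := andP bpq.
by apply: (@crossing_not_separated z J I b' p b q) (ws _ _ kC' kC);
   rewrite ?b'p ?notin_I ?notin_J.
Qed.

Definition diff_row (g : 'I_n.+1 -> R) : V := \row_i (g (hi i) - g (lo i)).

Lemma psum_diff_row g a : g ord0 = 0 -> psum (diff_row g) a = g a.
Proof.
move=> g0; case: a => a; elim: a => [|a IHa] an.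
  by rewrite psum0 -g0; congr g; apply: val_inj.
rewrite (psumS _ (Ordinal (an : (a < n)%N))) /= (IHa (ltnW an)) mxE addrC.
rewrite (_ : lo _ = Ordinal (ltnW an)); last exact: val_inj.
by rewrite subrK; congr g; apply: val_inj.
Qed.

(** From a point z of F with fewest minimizers, a displacement respecting the links can be followed
    a little both ways inside the cell. The functional exposing F is maximal at z, so the move stays
    in F, which is contained in a line. *)
Lemma edge_linked C M F v : filled (active C) M -> edge (cellC C M) F v ->
  exists z, (forall a b, connect (linked C z) a b -> psum v a = psum v b) /\
    forall d, (forall a b, linked C z a b -> psum d a = psum d b) ->
      exists t, d = t *: v.
Proof.
move=> Mf [faceF v0 [x [Fx Fxv Fline]]].
have [z Fz zmin] := face_cell_relint Mf faceF; exists z; split.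
  move=> a b; have v_linked c c' : linked C z c c' -> psum v c = psum v c'.
    case/linkedP=> k [kC ck c'k].
    have := low_eq (fintype.subsetP (zmin _ Fx k kC) _ ck)
                   (fintype.subsetP (zmin _ Fx k kC) _ c'k).
    have := low_eq (fintype.subsetP (zmin _ Fxv k kC) _ ck)
                   (fintype.subsetP (zmin _ Fxv k kC) _ c'k).
    by rewrite !psumB !psumD; lra.
  case/connectP=> s; elim: s a => [|c s IHs] a /=; first by move=> _ ->.
  by case/andP=> /v_linked-> cs bs; exact: IHs.
have [_ [c Fdef]] := faceF.
have [Mz mz] : cellC C M z /\ forall y, cellC C M y -> dot c y <= dot c z.
  by move: Fz; rewrite Fdef => -[].
have move_z d : (forall a b, linked C z a b -> psum d a = psum d b) ->
    exists2 e, 0 < e & cellC C M (z + e *: d).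
  move=> dl; apply: cell_low_perturb => // k kC a b ak bk.
  by apply: dl; apply/linkedP; exists k.
move=> d dl; have [e e0 Me] := move_z d dl.
have [|e' e'0 Me'] := move_z (- d).
  by move=> a b /dl dab; rewrite -!scaleN1r !psumZ dab.
have Fe : F (z + e *: d).
  have d_ge0 : 0 <= dot c d.
    have := mz _ Me'; rewrite scalerN -scaleNr dotDr dotZr gerDl.
    by rewrite mulNr oppr_le0 pmulr_rge0.
  rewrite Fdef; split=> // y /mz le_yz; rewrite dotDr dotZr.
  by apply: le_trans le_yz _; rewrite lerDl mulr_ge0 // ltW.
have [t0 zE] := Fline _ Fz; have [t1 zdE] := Fline _ Fe.
exists (e^-1 * (t1 - t0)); rewrite -scalerA scalerBl.
have -> : t1 *: v - t0 *: v = e *: d.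
  have -> : e *: d = (z + e *: d) - z by rewrite addrC addKr.
  by rewrite zdE zE opprD addrACA subrr add0r.
by rewrite scalerA mulVf ?scale1r // gt_eqF.
Qed.

(** If S is the interval from p to q, the partial sums rise at coordinate p - 1 and fall at
    coordinate q. The latter exists only for q < n; otherwise a single unit vector remains. *)
Lemma interval_direction (S : {set 'I_n.+1}) : S != finset.set0 -> ord0 \notin S ->
  (forall s t s' : 'I_n.+1, s \in S -> s' \in S -> (s < t < s')%N -> t \in S) ->
  gpolymatroid_direction (diff_row (fun a : 'I_n.+1 => (a \in S)%:R)).
Proof.
case/set0Pn=> s0 s0S S0 Sconv.
case: (@arg_minnP _ s0 (fun i => i \in S) val s0S) => p pS minp.
case: (@arg_maxnP _ s0 (fun i => i \in S) val s0S) => q qS maxq.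
have SE a : (a \in S) = (p <= a <= q)%N.
  apply/idP/andP=> [aS|[]]; first by split; [exact: minp | exact: maxq].
  rewrite leq_eqVlt => /predU1P[/val_inj<- //|pa].
  rewrite leq_eqVlt => /predU1P[/val_inj-> //|aq].
  by apply: (Sconv p a q) => //; rewrite pa.
have p_gt0 : (0 < p)%N.
  rewrite lt0n; apply: contra S0 => /eqP p0.
  by rewrite -(_ : p = ord0) //; apply: val_inj.
have pn : (p.-1 < n)%N by have := ltn_ord p; lia.
have psumE a : psum (diff_row (fun a : 'I_n.+1 => (a \in S)%:R)) a = (a \in S)%:R.
  by apply: psum_diff_row; rewrite (negPf S0).
have [nq|qn] := leqP n q.
  left; exists (Ordinal pn), 1; rewrite scale1r; apply: psum_inj => a.
  by rewrite psumE psum_delta SE /=; congr (_%:R); have := ltn_ord a; lia.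
right; exists (Ordinal pn), (Ordinal qn), 1; rewrite scale1r; split.
  by apply/negP => /eqP/(congr1 val) /=; have := minp q qS; rewrite /=; lia.
apply: psum_inj => a; rewrite psumE psumB !psum_delta SE /=.
have := minp q qS => /= pq.
case: (leqP p a) => pa; case: (leqP a q) => aq /=.
- have -> : (p.-1 < a)%N by lia.
  by rewrite subr0.
- have -> : (p.-1 < a)%N by lia.
  by rewrite subrr.
- by have -> : (p.-1 < a)%N = false; [lia | rewrite subr0].
- by lia.
Qed.

(** The indicator of any class avoiding index 0 respects the links, hence is proportional to the
    partial sums of v. Two distinct classes have non-proportional indicators, so only one avoids 0,
    and it is an interval by [linked_class_convex]. *)
Lemma edge_direction C M F v : weakly_separated_set C -> filled (active C) M ->
  edge (cellC C M) F v -> gpolymatroid_direction v.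
Proof.
move=> ws Mf Fv; have [z [v_class d_line]] := edge_linked Mf Fv.
have csym := linked_connect_sym C z.
have v0 : v != 0 by case: Fv.
have [s vs] : exists s : 'I_n.+1, psum v s != 0.
  apply/existsP; apply: contraNT v0; rewrite negb_exists => /forallP v0.
  apply/eqP; apply: psum_inj => a; have := v0 a; rewrite negbK => /eqP->.
  by rewrite -(scale0r 0) psumZ mul0r.
pose S t := [set a | connect (linked C z) t a]%SET.
have S_line t : ~~ connect (linked C z) t ord0 ->
    exists c, forall a, (a \in S t)%:R = c * psum v a.
  move=> t0; have g0 : (ord0 \in S t)%:R = 0 :> R by rewrite inE (negPf t0).
  have [|c dE] := d_line (diff_row (fun a : 'I_n.+1 => (a \in S t)%:R)).
    move=> a b ab; rewrite !psum_diff_row // !inE; congr (_%:R).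
    by rewrite (same_connect1r csym ab).
  by exists c => a; rewrite -psumZ -dE psum_diff_row.
have s0 : ~~ connect (linked C z) s ord0.
  by apply: contra vs => /v_class->; rewrite psum0.
have [c cS] := S_line s s0.
have c0 : c != 0.
  have := cS s; rewrite inE connect0 => /eqP; apply: contraTneq => ->.
  by rewrite mul0r oner_eq0.
have vE : v = c^-1 *: diff_row (fun a : 'I_n.+1 => (a \in S s)%:R).
  apply: psum_inj => a; rewrite psumZ psum_diff_row ?inE ?(negPf s0) //.
  by have := cS a; rewrite inE => ->; rewrite mulKf.
have other t : t \notin S s -> connect (linked C z) ord0 t.
  rewrite inE => st; apply: contraT => t0.
  have [|c' c'S] := S_line t; first by rewrite csym.
  have := c'S s; rewrite inE csym (negPf st) => /esym/eqP.
  rewrite mulf_eq0 (negPf vs) orbF => /eqP c'0.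
  by have := c'S t; rewrite inE connect0 c'0 mul0r => /eqP; rewrite oner_eq0.
have : gpolymatroid_direction (diff_row (fun a : 'I_n.+1 => (a \in S s)%:R)).
  apply: interval_direction; first by apply/set0Pn; exists s; rewrite inE.
    by rewrite inE.
  move=> s1 t s2; rewrite !inE => ss1 ss2 s1ts2; apply: contraT => st.
  case/negP: (st); apply: (connect_trans ss1).
  apply: (linked_class_convex ws s1ts2); last by apply: other; rewrite inE.
  by apply: (connect_trans _ ss2); rewrite csym.
rewrite vE => -[[i [t ->]]|[i [j [t [ij ->]]]]]; [left|right].
  by exists i, (c^-1 * t); rewrite scalerA.
by exists i, j, (c^-1 * t); rewrite scalerA.
Qed.

Lemma psum_offset_int k (a : nat) : exists m : int, psum (offset R k) a = m%:~R.
Proof.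
case: k => [[i|i]|I] /=.
- by exists 0; rewrite -(scale0r 0) psumZ mul0r.
- by exists (i < a)%:Z; rewrite psum_delta.
- by exists (cnt I a); rewrite psum_indic.
Qed.

Lemma cell_decomposition C M x : based M -> cellC C M x ->
  exists lam : {set 'I_n} -> R,
  [/\ forall J, 0 <= lam J, \sum_J lam J = 1, \sum_J lam J *: indic R J = x &
      forall J, lam J != 0 -> cellC C M (indic R J)].
Proof.
move=> Mb Mx; have [lam [l0 l1 lx lJ]] := cube_decomposition (cell_cube Mb Mx).
exists lam; split=> // J /lJ JP k kC; apply: fintype.subset_trans (Mx k kC) _.
apply/fintype.subsetP => a /lowP[aW amin]; apply/lowP; split=> // b bW.
have := amin b bW; rewrite !psumB.
have [m ->] := psum_offset_int k a; have [m' ->] := psum_offset_int k b => le_ab.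
by have := JP (m' - m) a b; rewrite !intrB; lra.
Qed.

(** As v is a mean of 0/1 points of the cell, the functional exposing v is maximal at each of them
    that has positive weight; uniqueness of the maximizer identifies them with v. *)
Lemma vertex_indic C M v : based M -> vertex (cellC C M) v ->
  exists J, v = indic R J.
Proof.
move=> Mb [_ [c vE]]; have [Mv mv] : argmax_set (cellC C M) (dot c) v by rewrite -vE.
have [lam [l0 l1 lx lJ]] := cell_decomposition Mb Mv.
have [J lJ0] : exists J, lam J != 0.
  apply/existsP; apply: contraTT isT; rewrite negb_exists => /forallP lam0.
  have := oner_neq0 R; rewrite -l1 big1 ?eqxx // => J _.
  by have := lam0 J; rewrite negbK => /eqP.
exists J; apply/esym; change ([set v] (indic R J)); rewrite vE; split; first exact: lJ.
have terms_ge0 J' : true -> 0 <= lam J' * (dot c v - dot c (indic R J')).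
  move=> _; have [->|/lJ MJ'] := eqVneq (lam J') 0; first by rewrite mul0r.
  by rewrite mulr_ge0 // subr_ge0 mv.
have sum0 : \sum_J' lam J' * (dot c v - dot c (indic R J')) = 0.
  under eq_bigr do rewrite mulrBr; rewrite sumrB -mulr_suml l1 mul1r.
  rewrite -{1}lx dotC dot_suml; apply/eqP; rewrite subr_eq0; apply/eqP.
  by apply: eq_bigr => J' _; rewrite dotZl dotC.
move=> y /mv; have /eqP : lam J * (dot c v - dot c (indic R J)) = 0.
  exact: (psumr_eq0P terms_ge0 sum0 isT).
by rewrite mulf_eq0 (negPf lJ0) /= subr_eq0 => /eqP->.
Qed.

Lemma weakly_separated_gmatroid C : weakly_separated_set C ->
  gmatroid_subdivision
    (common_refinement (cube R n) C (schubert_subdivision R)).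
Proof.
move=> ws; split; first exact: refinement_subdivision.
move=> F CF; have [_ Fpoly] := subdiv_cell (refinement_subdivision R C) CF.
move: CF => /refinementP[_ [M [Mf Mb FE]]]; split; last first.
  by move=> v; rewrite FE; exact: vertex_indic.
by split=> // G v; rewrite FE; exact: edge_direction.
Qed.

End WeaklySeparatedCells.

(** * Balanced triples in sets that are not weakly separated *)

Section Alternation.
Variable n : nat.
Implicit Types (A B I J X Y : {set 'I_n}) (p q r i : 'I_n) (a b s t : nat).

Lemma cntS J i : cnt J i.+1 = cnt J i + (i \in J).
Proof.
rewrite !cntE (bigD1 i) //= [in RHS](bigD1 i) //= ltnn ltnSn muln0 muln1 add0n addnC.
congr (_ + _); apply: eq_bigr => j ji; congr (_ * _).
by rewrite ltnS leq_eqVlt (_ : (j == i :> nat) = false) //; exact: negbTE.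
Qed.

Lemma cnt_set0 a : cnt (finset.set0 : {set 'I_n}) a = 0.
Proof. exact: big_set0. Qed.

Lemma leq_cnt J a b : a <= b -> cnt J a <= cnt J b.
Proof.
move=> ab; apply: leq_sum => i _; case: (ltnP i a) => // ia.
by rewrite (leq_trans ia ab).
Qed.

Lemma cnt_agree X Y a b : a <= b -> (forall i, a <= i < b -> (i \in X) = (i \in Y)) ->
  cnt X b + cnt Y a = cnt Y b + cnt X a.
Proof.
move=> ab XY; rewrite !cntE -!big_split; apply: eq_bigr => i _ /=.
have [/XY->|] := boolP (a <= i < b); first by lia.
by case: (i \in X); case: (i \in Y); lia.
Qed.

Lemma cnt_gt_ex J a b : a <= b -> cnt J a < cnt J b ->
  exists2 i, i \in J & a <= i < b.
Proof.
move=> ab lt_ab; have [|i] := @cnt_lt_ex n finset.set0 J a b ab.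
  by rewrite !cnt_set0; lia.
by rewrite finset.setD0 => iJ ?; exists i.
Qed.

Definition pattern A B s t := exists a1 b a2 : 'I_n,
  [/\ a1 \in A, b \in B, a2 \in A, s <= a1 < b & b < a2 < t].

(* With alpha, beta the counting functions of A and B, the equations say that
   B has as many elements in ]p, q[ as A in ]q, r[, and vice versa. *)
Definition balanced A B p q r :=
  [/\ p < q < r, [&& p \in A, q \in B & r \in A],
      cnt A q + cnt B q = cnt A r + cnt B p &
      cnt A q + cnt B q = cnt B r + cnt A p].

(** In a shortest interval both ends p and r lie in A and the excess of A over B is exactly 1. No b,
    a, b alternation occurs strictly inside, as cutting at a would leave an excess in one part.
    Since A and B are disjoint, [cnt A + cnt B] grows by steps of at most 1 and hits the value
    required at q; the excluded alternation puts q in B. *)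
Lemma pattern_balanced A B s t : [disjoint A & B] -> t <= n ->
  pattern A B s t -> cnt B t + cnt A s < cnt A t + cnt B s ->
  exists p q r, balanced A B p q r.
Proof.
move=> dAB; have AB i : i \in A -> (i \in B) = false by exact: disjointFr.
have [m] := ubnP (t - s); elim: m s t => // m IHm s t.
rewrite ltnS => tsm tn [a1 [b1 [a2 [a1A b1B a2A /andP[sa1 a1b1] /andP[b1a2 a2t]]]]] gt_AB.
have sn : s < n by have := ltn_ord a1; lia.
have rn : t.-1 < n by lia.
pose p := Ordinal sn; pose r := Ordinal rn.
have [pA|pA] := boolP (p \in A); last first.
  have sa1' : s < a1.
    rewrite ltn_neqAle sa1 andbT; apply: contra pA => /eqP e.
    by rewrite (_ : p = a1) //; apply: val_inj.
  apply: (IHm s.+1 t) => //; first by lia.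
    by exists a1, b1, a2; split; rewrite ?sa1' ?b1a2.
  by have := cntS A p; have := cntS B p; rewrite (negPf pA) /=; lia.
have rS : t = r.+1 by rewrite /=; lia.
have [rA|rA] := boolP (r \in A); last first.
  have a2t' : a2 < r.
    rewrite ltn_neqAle; apply/andP; split; last by rewrite /=; lia.
    by apply: contra rA => /eqP/val_inj <-.
  apply: (IHm s r) => //; rewrite /=; [by lia | by lia | |].
    by exists a1, b1, a2; split; rewrite ?sa1 ?b1a2.
  have := cntS A r; have := cntS B r; rewrite -rS (negPf rA) /=; lia.
apply: contrapT => nobal.
have small s' t' : t' - s' < t - s -> t' <= n -> pattern A B s' t' ->
    cnt A t' + cnt B s' <= cnt B t' + cnt A s'.
  move=> lt_st tn' pat; rewrite leqNgt; apply/negP => gt_AB'; apply: nobal.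
  by apply: IHm pat gt_AB' => //; lia.
have pb1 : p < b1 by exact: leq_ltn_trans sa1 a1b1.
have b1r : b1 < r by rewrite /=; lia.
have Ap := cntS A p; have Bp := cntS B p; have Ar := cntS A r; have Br := cntS B r.
rewrite pA (AB p pA) /= in Ap Bp; rewrite rA (AB r rA) -rS in Ar Br.
have Bb1 := cntS B b1; rewrite b1B in Bb1.
have Ab1 := cntS A b1; rewrite (disjointFl dAB b1B) in Ab1.
have leBb1 : cnt B s <= cnt B b1 by apply: leq_cnt; exact: ltnW.
have leBr : cnt B b1.+1 <= cnt B r by exact: leq_cnt.
rewrite /= in Ap Bp Ar Br leBr.
have count : cnt A t + cnt B s = (cnt B t + cnt A s).+1.
  (* With an excess of 2 or more, dropping an end keeps an excess. Minimality then leaves only p and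
     r in A, and as b1 lies in B the excess is at most 1. *)
  apply/eqP; rewrite eqn_leq gt_AB andbT leqNgt; apply/negP => gt2.
  have A1 : cnt A b1 <= cnt A s.+1.
    rewrite leqNgt; apply/negP => /(cnt_gt_ex pb1)[a aA /andP[sa ab1]].
    have lt1 : t - s.+1 < t - s by lia.
    have /(small _ _ lt1 tn) : pattern A B s.+1 t; last by lia.
    by exists a, b1, r; split; rewrite ?sa ?b1r ?rS ?ltnSn.
  have A2 : cnt A t.-1 <= cnt A b1.+1.
    rewrite leqNgt; apply/negP => lt1; have [a aA /andP[b1a ar]] := cnt_gt_ex b1r lt1.
    have lt2 : r - s < t - s by rewrite /= in b1r *; lia.
    have /(small _ _ lt2 (ltnW rn)) : pattern A B s r; last by rewrite /= in lt1 *; lia.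
    by exists p, b1, a; split; rewrite ?b1a //= leqnn.
  by lia.
have no_bab (a c1 c2 : 'I_n) : a \in A -> c1 \in B -> c2 \in B ->
    p < c1 < a -> a < c2 < r -> False.
  move=> aA c1B c2B /andP[pc1 c1a] /andP[ac2 c2r].
  have Aa := cntS A a; have Ba := cntS B a; rewrite aA (AB a aA) in Aa Ba.
  have ar := ltn_trans ac2 c2r; have pa := ltn_trans pc1 c1a.
  have h1 : cnt A a.+1 + cnt B s <= cnt B a.+1 + cnt A s.
    apply: small => //; first by rewrite /= in pa ar; clear - pa ar; lia.
    by exists p, c1, a; split; rewrite ?c1a ?ltnSn ?andbT //= pc1 leqnn.
  have h2 : cnt A t + cnt B a <= cnt B t + cnt A a.
    apply: small => //; first by rewrite /= in pa ar; clear - pa ar; lia.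
    by exists a, c2, r; split; rewrite ?ac2 ?c2r ?rS ?leqnn //= ltnSn.
  by rewrite /= in h1 h2; clear - h1 h2 Aa Ba count; lia.
(* By [count], the two equations of [balanced] prescribe this same value for [cnt A q + cnt B q]. *)
pose T := cnt A t.-1 + cnt B s.
have exT : exists y, T < cnt A y + cnt B y by exists r; rewrite /T /=; lia.
case: (ex_minnP exT) => y Ty miny.
have yr : y <= r by apply: miny; rewrite /T /=; lia.
case: y Ty miny yr => [|y Ty miny yr]; first by rewrite !cnt0.
pose q : 'I_n := Ordinal (leq_trans yr (ltnW rn)).
have Tq : cnt A q + cnt B q <= T.
  by rewrite leqNgt; apply/negP => /miny; rewrite ltnn.
have Aq := cntS A q; have Bq := cntS B q; rewrite /= in Aq Bq.
have leApr : cnt A s.+1 <= cnt A t.-1.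
  by apply: leq_cnt; rewrite (leq_ltn_trans (ltnW pb1) b1r).
have pq : p < q.
  rewrite ltnNge; apply/negP => qp.
  have : cnt A y.+1 <= cnt A s.+1 by apply: leq_cnt.
  have : cnt B y.+1 <= cnt B s.+1 by apply: leq_cnt.
  by move: Ty; rewrite /T /=; lia.
have qA : q \in A -> False.
  move=> qA; rewrite qA (AB q qA) in Aq Bq.
  have leAq : cnt A y.+1 <= cnt A t.-1 by apply: leq_cnt.
  have leAp : cnt A s.+1 <= cnt A y by apply: leq_cnt.
  rewrite /T /= in Ty Tq.
  have [||c1 c1B /andP[pc1 c1q]] := @cnt_gt_ex B s y; [exact: ltnW | lia |].
  have [||c2 c2B /andP[qc2 c2r]] := @cnt_gt_ex B y t.-1; [exact: ltnW | lia |].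
  apply: (no_bab q c1 c2) => //=.
    rewrite c1q andbT ltn_neqAle pc1 andbT; apply/eqP => e.
    by have := AB p pA; rewrite (_ : p = c1) ?c1B //; apply: val_inj.
  rewrite c2r andbT ltn_neqAle qc2 andbT; apply/eqP => e.
  by have := AB q qA; rewrite (_ : q = c2) ?c2B //; apply: val_inj.
apply: nobal; exists p, q, r.
rewrite (negPf (introN idP qA)) in Aq.
have qB : q \in B by move: Bq; rewrite /T /= in Ty Tq; case: (q \in B) => //; lia.
rewrite qB in Bq; split=> //; [by rewrite pq | by rewrite pA qB rA | |].
- by rewrite /T /= in Ty Tq *; lia.
- by rewrite /T /= in Ty Tq *; lia.
Qed.

Lemma not_surrounds_pattern A B : [disjoint A & B] -> ~ surrounds B A ->
  exists a1 b a2 : 'I_n, [/\ a1 \in A, b \in B, a2 \in A, a1 < b & b < a2].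
Proof.
move=> dAB nsur; apply: contrapT => nopat; apply: nsur.
pose B1 := [set b in B | [forall (a | a \in A), b < a]].
exists B1, (B :\: B1); split.
- by apply/setP => b; rewrite !inE; case: (b \in B); rewrite /= ?andbT ?orbN ?andbF.
- rewrite -finset.setI_eq0; apply/eqP/setP => b; rewrite !inE.
  by case: (b \in B); rewrite /= ?andbT ?andbN.
- by move=> b a; rewrite inE => /andP[_ /forall_inP bA] /bA.
move=> a b aA; rewrite !inE negb_and => /andP[+ bB]; rewrite bB /= negb_forall_in.
have neq (c : 'I_n) : c \in A -> c != b.
  by move=> cA; apply: contraTneq cA => ->; rewrite (disjointFl dAB bB).
case/exists_inP => c cA; rewrite -leqNgt leq_eqVlt val_eqE (negPf (neq c cA)) /= => cb.
rewrite ltnNge; apply/negP; rewrite leq_eqVlt val_eqE eq_sym (negPf (neq a aA)) /= => ba.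
by apply: nopat; exists c, b, a.
Qed.

Lemma not_separated_balanced I J : ~ weakly_separated I J ->
  exists p q r, balanced (I :\: J) (J :\: I) p q r \/ balanced (J :\: I) (I :\: J) p q r.
Proof.
wlog le_JI : I J / #|J| <= #|I|.
  move=> wlog_le; have [|/ltnW le_IJ] := leqP #|J| #|I|; first exact: wlog_le.
  move=> nws; have [|p [q [r bal]]] := wlog_le J I le_IJ.
    by move=> ws; apply: nws; case: ws; [right | left].
  by exists p, q, r; apply/or_comm.
move=> nws; set A := I :\: J; set B := J :\: I.
have dAB : [disjoint A & B].
  rewrite -finset.setI_eq0; apply/eqP/setP => i; rewrite !inE.
  by case: (i \in I); rewrite ?andbF.
have dBA : [disjoint B & A] by rewrite disjoint_sym.
have cA := cnt_full A (leqnn n); have cB := cnt_full B (leqnn n).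
have le_BA : #|B| <= #|A|.
  by have := cardsID J I; have := cardsID I J; rewrite (finset.setIC J I) -/A -/B; lia.
have [a1 [b1 [a2 [a1A b1B a2A a1b1 b1a2]]]] : exists a1 b a2 : 'I_n,
    [/\ a1 \in A, b \in B, a2 \in A, a1 < b & b < a2].
  by apply: not_surrounds_pattern dAB _ => sBA; apply: nws; left.
move: le_BA; rewrite leq_eqVlt => /predU1P[eq_BA|lt_BA]; last first.
  have [||p [q [r bal]]] := @pattern_balanced A B 0 n dAB (leqnn n).
  - by exists a1, b1, a2; split; rewrite ?a1b1 ?b1a2 /=.
  - by rewrite cA cB !cnt0; lia.
  by exists p, q, r; left.
have [b3 [a3 [b4 [b3B a3A b4B b3a3 a3b4]]]] : exists b3 a b4 : 'I_n,
    [/\ b3 \in B, a \in A, b4 \in B, b3 < a & a < b4].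
  apply: not_surrounds_pattern dBA _ => sAB; apply: nws; right; split=> //.
  by have := cardsID J I; have := cardsID I J; rewrite (finset.setIC J I) -/A -/B; lia.
(* For equal sizes both alternations occur. Deleting the least element m of the union gives the set
   without m an excess of 1 and leaves its own alternation with enough room. *)
case: (@arg_minnP _ a1 (fun i => (i \in A) || (i \in B)) val); rewrite ?a1A //.
move=> m mAB min_m; have Am := cntS A m; have Bm := cntS B m.
have lt_m i : (i \in A) || (i \in B) -> i != m -> m < i.
  by move=> /min_m /= mi im; rewrite ltn_neqAle mi eq_sym im.
have cm : cnt A m = 0 /\ cnt B m = 0.
  split; apply: big1 => i iP; have := min_m i; rewrite iP ?orbT /= => /(_ isT);
    by case: ltnP => //; lia.
have [cAm cBm] := cm.
have [mB|mB] := boolP (m \in B).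
  have [||p [q [r bal]]] := @pattern_balanced A B m.+1 n dAB (leqnn n).
  - exists a1, b1, a2; split; rewrite ?b1a2 ?a1b1 ?ltn_ord ?andbT //.
    apply: lt_m; rewrite ?a1A //.
    by apply: contraTneq a1A => ->; rewrite (disjointFl dAB mB).
  - by rewrite cA cB Am Bm mB (disjointFl dAB mB) cAm cBm eq_BA; clear; lia.
  by exists p, q, r; left.
have mA : m \in A by move: mAB; rewrite (negPf mB) orbF.
have [||p [q [r bal]]] := @pattern_balanced B A m.+1 n dBA (leqnn n).
- exists b3, a3, b4; split; rewrite ?b3a3 ?a3b4 ?ltn_ord ?andbT //.
  by apply: lt_m; rewrite ?b3B ?orbT //; apply: contraNneq mB => <-.
- by rewrite cA cB Am Bm mA (negPf mB) cAm cBm eq_BA; clear; lia.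
by exists p, q, r; right.
Qed.

Lemma cnt_setT a : a <= n -> cnt (finset.setT : {set 'I_n}) a = a.
Proof.
elim: a => [|a IHa] an; first by rewrite cnt0.
by rewrite (cntS _ (Ordinal an)) /= IHa ?(ltnW an) // inE addn1.
Qed.

Lemma cnt_setD X Y a : cnt X a = cnt (X :&: Y) a + cnt (X :\: Y) a.
Proof.
rewrite !cntE -big_split; apply: eq_bigr => i _ /=; rewrite !inE.
by case: (i \in X); case: (i \in Y); lia.
Qed.

Lemma cnt_setU X Y a : cnt (X :|: Y) a + cnt (X :&: Y) a = cnt X a + cnt Y a.
Proof.
rewrite !cntE -!big_split; apply: eq_bigr => i _ /=; rewrite !inE.
by case: (i \in X); case: (i \in Y); lia.
Qed.

(* Y is one endpoint of an edge of the refinement in direction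
   [e_p - e_q + e_r]; the inequalities locate the minima of the affine functions
   of I (at p.+1 and r.+1) and of J (at p and r) along that edge. *)
Lemma balanced_endpoint I J p q r : balanced (I :\: J) (J :\: I) p q r ->
  exists Y, [/\ p \notin Y, q \in Y, r \notin Y,
    forall b, b <= n ->
      cnt Y p.+1 + cnt I b + ~~ ((p < b <= q) || (r < b)) <= cnt Y b + cnt I p.+1 /\
      cnt Y p + cnt J b <= cnt Y b + cnt J p
    & cnt Y r.+1 + cnt I p.+1 = cnt Y p.+1 + cnt I r.+1 /\
      cnt Y r + cnt J p = cnt Y p + cnt J r].
Proof.
set A := I :\: J; set B := J :\: I.
move=> [/andP[pq qr] /and3P[pA qB rA] eqA eqB].
(* Empty before p and full after r, Y makes both [cnt Y - cnt I] and [cnt Y - cnt J] fall before p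
   and rise after r. The union makes them climb between p and q, the intersection makes them descend
   between q and r, and [balanced] makes climb and descent cancel. *)
pose Y := [set i : 'I_n | [|| (p < i < q) && (i \in I :|: J), i == q,
  (q < i < r) && (i \in I :&: J) | r < i]].
have Y1 b : b <= p.+1 -> cnt Y b = 0.
  move=> bp; have := @cnt_agree Y finset.set0 0 b isT.
  rewrite !cnt_set0 !cnt0 !addn0; apply=> i /andP[_ ib].
  by rewrite !inE -val_eqE /=; lia.
have Y2 b : p < b <= q -> cnt Y b + cnt (I :|: J) p.+1 = cnt (I :|: J) b.
  move=> /andP[pb bq]; rewrite (@cnt_agree _ (I :|: J)) // ?Y1 ?addn0 //.
  move=> i /andP[pi ib]; rewrite inE -val_eqE /=.
  by rewrite pi (leq_trans ib bq) /=; case: (i \in _) => //; lia.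
have Yq : q \in Y by rewrite inE eqxx orbT.
have Yp : p \notin Y by rewrite inE -val_eqE /=; lia.
have Yr : r \notin Y by rewrite inE -val_eqE /=; lia.
have Y3 b : q < b <= r ->
    cnt Y b + cnt (I :&: J) q.+1 = cnt (I :&: J) b + (cnt Y q).+1.
  move=> /andP[qb br]; rewrite (@cnt_agree _ (I :&: J)) // ?(cntS Y q) ?Yq ?addn1 //.
  move=> i /andP[qi ib]; rewrite inE -val_eqE /=.
  by rewrite qi (leq_trans ib br) /=; case: (i \in _) => //; lia.
have Y4 b : r < b <= n -> cnt Y b + r.+1 = b + cnt Y r.
  move=> /andP[rb bn]; have := @cnt_agree Y finset.setT r.+1 b rb.
  rewrite !cnt_setT // (cntS Y r) (negPf Yr) addn0; apply.
  by move=> i /andP[ri _]; rewrite !inE ri !orbT.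
have IE b : cnt I b = cnt (I :&: J) b + cnt A b := cnt_setD I J b.
have JE b : cnt J b = cnt (I :&: J) b + cnt B b.
  by rewrite finset.setIC; exact: cnt_setD.
have UE b : cnt (I :|: J) b = cnt (I :&: J) b + cnt A b + cnt B b.
  by have := cnt_setU I J b; rewrite IE JE; lia.
have S i : [/\ cnt A i.+1 = cnt A i + (i \in A), cnt B i.+1 = cnt B i + (i \in B)
    & cnt (I :&: J) i.+1 = cnt (I :&: J) i + (i \in I :&: J)] by split; exact: cntS.
have disjA i : i \in A -> (i \in B) = false /\ (i \in I :&: J) = false.
  by rewrite !inE; case: (i \in I); case: (i \in J).
have disjB i : i \in B -> (i \in A) = false /\ (i \in I :&: J) = false.
  by rewrite !inE; case: (i \in I); case: (i \in J).
have [[pB pN] [qA qN] [rB rN]] := And3 (disjA p pA) (disjB q qB) (disjA r rA).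
have [Ap Bp Np] := S p; have [Aq Bq Nq] := S q; have [Ar Br Nr] := S r.
rewrite pA pB pN in Ap Bp Np; rewrite qA qB qN in Aq Bq Nq; rewrite rA rB rN in Ar Br Nr.
exists Y; split=> //; last first.
  have := Y3 r; rewrite qr leqnn => /(_ isT); have := Y2 q; rewrite pq leqnn => /(_ isT).
  have := Y1 p (leqnSn p); have := Y1 p.+1 (leqnn _); have := cntS Y r.
  rewrite (negPf Yr) !UE !IE !JE.
  by clear - Ap Bp Np Aq Bq Nq Ar Br Nr eqA eqB; lia.
move=> b bn; have Yp0 := Y1 p (leqnSn p); have YpS0 := Y1 p.+1 (leqnn _).
have Yq2 := Y2 q; rewrite pq leqnn in Yq2; have {}Yq2 := Yq2 isT.
have Yr3 := Y3 r; rewrite qr leqnn in Yr3; have {}Yr3 := Yr3 isT.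
rewrite UE in Yq2; rewrite (UE q) in Yq2.
have [bp|pb] := leqP b p.
  have := leq_cnt (I :&: J) bp; have := leq_cnt A bp; have := leq_cnt B bp.
  have := Y1 b (leqW bp); rewrite !IE !JE.
  by clear - Ap Bp Np Aq Bq Nq Ar Br Nr eqA eqB Yp0 YpS0 Yq2 Yr3 bp; lia.
have [bq|qb] := leqP b q.
  have := leq_cnt A pb; have := leq_cnt B pb.
  have := Y2 b; rewrite pb bq => /(_ isT); rewrite !UE !IE !JE.
  by clear - Ap Bp Np Aq Bq Nq Ar Br Nr eqA eqB Yp0 YpS0 Yq2 Yr3 pb bq; lia.
have [br|rb] := leqP b r.
  have := leq_cnt A br; have := leq_cnt B br.
  have := Y3 b; rewrite qb br => /(_ isT); rewrite !IE !JE.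
  by clear - Ap Bp Np Aq Bq Nq Ar Br Nr eqA eqB Yp0 YpS0 Yq2 Yr3 pb qb br; lia.
have le_T X : cnt X b + r.+1 <= b + cnt X r.+1.
  have := leq_cnt (~: X) rb; have E c := cnt_setD finset.setT X c.
  have := E b; have := E r.+1; rewrite !cnt_setT // !finset.setTI finset.setTD.
  by clear; lia.
have := Y4 b; rewrite rb bn => /(_ isT).
have := le_T I; have := le_T J; rewrite !IE !JE.
by clear - Ap Bp Np Aq Bq Nq Ar Br Nr eqA eqB Yp0 YpS0 Yq2 Yr3 pb qb rb; lia.
Qed.

End Alternation.

(** * The bad edge produced by a balanced triple *)

Section BadEdge.
Variables (R : realType) (n : nat).
Local Open Scope ring_scope.
Local Open Scope classical_set_scope.
Local Notation V := 'rV[R]_n.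
Local Notation K := ('I_n + 'I_n + {set 'I_n})%type.
Local Notation argmin := (low (@window n) (@offset R n)).
Local Notation cellC C M := (cell (@window n) (@offset R n) (active C) M).
Local Notation refinement C :=
  (common_refinement (cube R n) C (schubert_subdivision R)).
Local Notation e i := (delta_mx 0 i : V).
Implicit Types (x y z d v : V) (k : K) (I J Y : {set 'I_n}) (p q r : 'I_n).
Implicit Types (C : {set {set 'I_n}}).

(* The jump psum v a is 0 or 1 while all other values are integers, so a
   minimizer survives at the other endpoint unless every minimizer jumps, and
   then they all do. *)
Lemma common_argmin Y v k :
  (forall a : 'I_n.+1, psum v a = 0 \/ psum v a = 1) ->
  argmin (indic R Y) k :&: argmin (indic R Y + v) k != finset.set0.
Proof.
move=> v01; have vE (a : 'I_n.+1) : psum (indic R Y + v - offset R k) a =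
    psum (indic R Y - offset R k) a + psum v a.
  by rewrite !psumB psumD; ring.
have intE (a : 'I_n.+1) : exists m : int, psum (indic R Y - offset R k) a = m%:~R.
  have [m mE] := psum_offset_int R k a; exists ((cnt Y a : int) - m).
  by rewrite psumB psum_indic mE intrB.
have /set0Pn[a0 a0Y] := argmin_neq0 (indic R Y) k.
have [/existsP[a /andP[aY /eqP va]]|] :=
    boolP [exists a : 'I_n.+1, (a \in argmin (indic R Y) k) && (psum v a == 0)].
  apply/set0Pn; exists a; rewrite inE aY; have /lowP[aW amin] := aY.
  apply/lowP; split=> // b bW; rewrite !vE va addr0.
  by have := amin b bW; have [->|->] := v01 b; lra.
rewrite negb_exists => /forallP no0; apply/set0Pn; exists a0; rewrite inE a0Y.
have /lowP[a0W a0min] := a0Y; apply/lowP; split=> // b bW; rewrite !vE.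
have jump (a : 'I_n.+1) : a \in argmin (indic R Y) k -> psum v a = 1.
  by move=> aY; have := no0 a; rewrite aY /=; case: (v01 a) => [->|//]; rewrite eqxx.
rewrite (jump a0 a0Y); have [bY|bY] := boolP (b \in argmin (indic R Y) k).
  by rewrite (jump b bY) lerD2r a0min.
have lt_ab : psum (indic R Y - offset R k) a0 < psum (indic R Y - offset R k) b.
  by rewrite ltNge; apply: contra bY; exact: in_low.
have [m mE] := intE a0; have [m' m'E] := intE b.
move: lt_ab; rewrite mE m'E ltr_int => lt_mm'.
have : m%:~R + 1%:~R <= m'%:~R :> R by rewrite -intrD ler_int lezD1.
by have [->|->] := v01 b; lra.
Qed.

Lemma ltn_eqF_ord p q : (p < q)%N -> (p == q) = false.
Proof. by move=> pq; apply/negbTE; rewrite -val_eqE neq_ltn pq. Qed.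

Lemma alternating_not_gpolymatroid p q r : (p < q < r)%N ->
  ~ gpolymatroid_direction (e p - e q + e r).
Proof.
move=> /andP[pq qr]; have pr := ltn_trans pq qr.
case=> [[i [t /rowP vE]]|[i [j [t [_ vE]]]]].
  have := vE p; have := vE q; rewrite !mxE !eqxx /=.
  rewrite [q == p]eq_sym (ltn_eqF_ord pq) (ltn_eqF_ord qr) (ltn_eqF_ord pr) /=.
  have [pi|_] := eqVneq p i; last by rewrite mulr0; lra.
  have [qi|_] := eqVneq q i; last by rewrite mulr0; lra.
  by move: pq; rewrite pi qi ltnn.
have := congr1 (fun x => psum x n) vE.
rewrite /= psumZ psumD !psumB !psum_delta !ltn_ord subrr mulr0 add0r => /eqP.
by rewrite oner_eq0.
Qed.

Section Segment.
Variables (C : {set {set 'I_n}}) (I J Y : {set 'I_n}) (p q r : 'I_n).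
Hypotheses (pq : (p < q)%N) (qr : (q < r)%N).
Hypotheses (pY : p \notin Y) (qY : q \in Y) (rY : r \notin Y).

Let v : V := e p - e q + e r.
Let y : V := indic R Y.
Let M k := argmin y k :&: argmin (y + v) k.

Let pr : (p < r)%N := ltn_trans pq qr.

Lemma psum_segment (a : nat) : psum v a = ((p < a <= q) || (r < a))%N%:R.
Proof.
rewrite /v psumD psumB !psum_delta.
have [pa|pa] := ltnP p a; have [qa|qa] := ltnP q a; have [ra|ra] := ltnP r a;
  rewrite /= ?subr0 ?addr0 ?subrr ?add0r //; clear - pa qa ra pq qr; lia.
Qed.

Lemma segment_off i : i != p -> i != q -> i != r -> v 0 i = 0.
Proof.
by move=> ip iq ir; rewrite !mxE !eqxx /= (negPf ip) (negPf iq) (negPf ir) subrr addr0.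
Qed.

Lemma segment_p : v 0 p = 1.
Proof. by rewrite !mxE !eqxx /= !ltn_eqF_ord // subr0 addr0. Qed.

Lemma segment_q : v 0 q = -1.
Proof. by rewrite !mxE !eqxx /= [q == p]eq_sym !ltn_eqF_ord // addr0 sub0r. Qed.

Lemma segment_r : v 0 r = 1.
Proof.
by rewrite !mxE !eqxx /= [r == p]eq_sym [r == q]eq_sym !ltn_eqF_ord // subrr add0r.
Qed.

Lemma segment_cube : cube R n y /\ cube R n (y + v).
Proof.
have yE i : y 0 i = (i \in Y)%:R by rewrite mxE.
split=> i; first by rewrite yE; case: (i \in Y); rewrite lexx ler01.
rewrite mxE yE; have [->|ip] := eqVneq i p.
  by rewrite segment_p (negPf pY) add0r lexx ler01.
have [->|iq] := eqVneq i q; first by rewrite segment_q qY subrr lexx ler01.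
have [->|ir] := eqVneq i r; first by rewrite segment_r (negPf rY) add0r lexx ler01.
by rewrite segment_off // addr0; case: (i \in Y); rewrite lexx ler01.
Qed.

Lemma segment_based : based M.
Proof.
move=> i; have [yQ yvQ] := segment_cube.
have [ly hy] := (cube_based y).1 yQ i.
have [lyv hyv] := (cube_based (y + v)).1 yvQ i.
by rewrite /M !finset.in_setI ly hy lyv hyv.
Qed.

Lemma segment_refinement : refinement C (cellC C M).
Proof.
apply/refinementP; split; first by exists y => k _; exact: finset.subsetIl.
exists M; split=> //; last exact: segment_based.
move=> k _; apply: common_argmin => a; rewrite psum_segment.
by case: (_ || _); [right|left].
Qed.

Hypotheses (IC : I \in C) (JC : J \in C).
Hypotheses (pI : hi p \in M (inr I)) (rI : hi r \in M (inr I)).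
Hypotheses (pJ : lo p \in M (inr J)) (rJ : lo r \in M (inr J)).

Lemma segment_edge : edge (cellC C M) (cellC C M) v.
Proof.
have My : cellC C M y by move=> k _; exact: finset.subsetIl.
have Myv : cellC C M (y + v) by move=> k _; exact: finset.subsetIr.
split.
- split; first by exists y.
  exists 0; apply/seteqP; split=> x; last by case.
  by move=> Mx; split=> // z _; rewrite !dot0l.
- by apply/eqP => v0; have /eqP := segment_p; rewrite v0 mxE eq_sym oner_eq0.
exists y; split=> // z Mz; pose d := z - y.
have d_const k (a b : 'I_n.+1) : k \in active C -> a \in M k -> b \in M k ->
    psum d a = psum d b.
  move=> kC aM bM; apply: esym.
  have := low_eq (fintype.subsetP (Mz k kC) _ aM) (fintype.subsetP (Mz k kC) _ bM).
  have := low_eq (fintype.subsetP (My k kC) _ aM) (fintype.subsetP (My k kC) _ bM).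
  by rewrite /d !psumB; lra.
have [yQ yvQ] := segment_cube.
(* Both endpoints have the same coordinate 0 or 1 here, so both indices of the matching cube window
   are common minimizers, which fixes the coordinate on the whole cell. *)
have d_off i : i != p -> i != q -> i != r -> d 0 i = 0.
  move=> ip iq ir; have yvi : (y + v) 0 i = y 0 i by rewrite mxE segment_off // addr0.
  have zQ : cube R n z := cell_cube segment_based Mz.
  have [ly hy] := (cube_based y).1 yQ i; have [lyv hyv] := (cube_based (y + v)).1 yvQ i.
  have yi : y 0 i = (i \in Y)%:R by rewrite mxE.
  rewrite /d mxE [X in _ + X]mxE; have /andP[z0 z1] := zQ i.
  have zi : z 0 i = y 0 i; last by rewrite zi subrr.
  have inC j : inl j \in active C by rewrite inE.
  apply/eqP; rewrite eq_le yi; case iY: (i \in Y) in yi *.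
    rewrite z1 -argmin_lo_upper; apply: (fintype.subsetP (Mz _ (inC _))).
    by rewrite finset.in_setI !argmin_lo_upper yvi yi lexx.
  rewrite z0 -argmin_hi_lower andbT; apply: (fintype.subsetP (Mz _ (inC _))).
  by rewrite finset.in_setI !argmin_hi_lower yvi yi lexx.
have dE : d = d 0 p *: e p + d 0 q *: e q + d 0 r *: e r.
  apply/rowP => i; have := d_off i; move: (d) => d' d'_off; rewrite !mxE !eqxx /=.
  have [->|ip] := eqVneq i p.
    by rewrite (ltn_eqF_ord pq) (ltn_eqF_ord pr) /= ?mulr1 ?mulr0 ?addr0 ?add0r.
  have [->|iq] := eqVneq i q.
    by rewrite (ltn_eqF_ord qr) /= ?mulr1 ?mulr0 ?addr0 ?add0r.
  have [->|ir] := eqVneq i r; first by rewrite /= ?mulr1 ?mulr0 ?addr0 ?add0r.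
  by rewrite d'_off // /= ?mulr1 ?mulr0 ?addr0 ?add0r.
have psum_d (a : nat) :
    psum d a = d 0 p * (p < a)%:R + d 0 q * (q < a)%:R + d 0 r * (r < a)%:R.
  by rewrite [in LHS]dE !psumD !psumZ !psum_delta.
have IK : inr I \in active C by rewrite inE.
have JK : inr J \in active C by rewrite inE.
exists (d 0 p); rewrite -[z](subrK y) -/d addrC; congr (_ + _).
(* The minimizers of I give d_q + d_r = 0 and those of J give d_p + d_q = 0, so d is d_p times v. *)
have := d_const _ _ _ IK pI rI; have := d_const _ _ _ JK pJ rJ.
rewrite !psum_d !lift0 /= !ltnS !ltnn !leqnn qr pr (ltnW qr) (ltnW pr).
rewrite !(leqNgt q) !(leqNgt r) !(ltnNge q) !(ltnNge r) (ltnW pq) (ltnW pr) pq pr /=.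
move=> h1 h2; rewrite [LHS]dE /v !scalerDr scalerN -scaleNr.
by congr (_ *: _ + _ *: _ + _ *: _); lra.
Qed.

End Segment.

Lemma balanced_not_gmatroid C I J p q r : I \in C -> J \in C ->
  balanced (I :\: J) (J :\: I) p q r -> ~ gmatroid_subdivision (refinement C).
Proof.
move=> IC JC bal [_ gm]; have [/andP[pq qr] _ _ _] := bal.
have [Y [pY qY rY Ymin [eqI eqJ]]] := balanced_endpoint bal.
have pr := ltn_trans pq qr.
pose v : V := e p - e q + e r; pose y := indic R Y.
have psum_y I' (a : nat) : psum (y - indic R I') a = (cnt Y a)%:R - (cnt I' a)%:R.
  by rewrite psumB !psum_indic.
have psum_yv I' (a : nat) : psum (y + v - indic R I') a =
    (cnt Y a)%:R - (cnt I' a)%:R + ((p < a <= q) || (r < a))%N%:R.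
  by rewrite -psum_y -psum_segment // !psumB psumD; ring.
pose M k := argmin y k :&: argmin (y + v) k.
have natP m m' : (m <= m')%N -> m%:R <= m'%:R :> R by rewrite ler_nat.
have minM I' (a : 'I_n.+1) : (forall b : 'I_n.+1,
      psum (y - indic R I') a <= psum (y - indic R I') b) ->
    (forall b : 'I_n.+1,
      psum (y + v - indic R I') a <= psum (y + v - indic R I') b) ->
    a \in M (inr I').
  move=> min1 min2; rewrite inE; apply/andP; split; apply/lowP;
    by split=> [|b _]; rewrite ?inE.
have eqM I' (a b : 'I_n.+1) : a \in M (inr I') ->
    psum (y - indic R I') b = psum (y - indic R I') a ->
    psum (y + v - indic R I') b = psum (y + v - indic R I') a -> b \in M (inr I').
  rewrite !finset.in_setI => /andP[a1 a2] e1 e2.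
  by rewrite (in_low a1) ?(in_low a2) ?inE //= ?e1 ?e2.
have pI : hi p \in M (inr I).
  apply: minM => b; have [/natP + _] := Ymin b (ltn_ord b).
    rewrite !psum_y !lift0 !natrD.
    by have := ler0n R (~~ ((p < b <= q) || (r < b)))%N; clear; lra.
  (* At the second endpoint the value at [hi p] has grown by 1; the negated boolean in [Ymin]
     supplies this 1 at the indices that do not jump. *)
  rewrite !psum_yv !lift0 !natrD ltnSn pq.
  by case: (_ || _) => /=; rewrite ?mulr1n ?mulr0n; clear; lra.
have rI : hi r \in M (inr I).
  move/(congr1 (fun m : nat => m%:R : R)): eqI; rewrite !natrD => eqI.
  apply: (eqM I _ _ pI); rewrite ?psum_y ?psum_yv !lift0; first by clear - eqI; lra.
  by rewrite ltnSn pq ltnSn orbT /=; clear - eqI; lra.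
have pJ : lo p \in M (inr J).
  apply: minM => b; have [_ /natP] := Ymin b (ltn_ord b).
    by rewrite !psum_y !natrD /=; clear; lra.
  rewrite !psum_yv !natrD ltnn (ltnNge r) (ltnW pr) /=.
  by case: (_ || _) => /=; rewrite ?mulr1n ?mulr0n; clear; lra.
have rJ : lo r \in M (inr J).
  move/(congr1 (fun m : nat => m%:R : R)): eqJ; rewrite !natrD => eqJ.
  apply: (eqM J _ _ pJ); rewrite ?psum_y ?psum_yv /=; first by clear - eqJ; lra.
  rewrite !ltnn pr (leqNgt r) qr (ltnNge r) (ltnW pr) /=.
  by clear - eqJ; lra.
have [[_ edgeF] _] := gm _ (segment_refinement C pq qr pY qY rY).
apply: (@alternating_not_gpolymatroid p q r); first by rewrite pq.
exact: edgeF (segment_edge pq qr pY qY rY IC JC pI rI pJ rJ).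
Qed.

Lemma gmatroid_weakly_separated C :
  gmatroid_subdivision (refinement C) -> weakly_separated_set C.
Proof.
move=> gm I J IC JC; apply: contrapT => /not_separated_balanced[p [q [r]]].
by case=> [/(balanced_not_gmatroid IC JC)|/(balanced_not_gmatroid JC IC)]; exact.
Qed.

End BadEdge.

Unset Implicit Arguments.

Theorem theorem1p3 (R : realType) (n : nat) (C : {set {set 'I_n}}) :
  gmatroid_subdivision (common_refinement (cube R n) C (schubert_subdivision R))
  <-> weakly_separated_set C.
Proof.
split; first exact: gmatroid_weakly_separated.
exact: weakly_separated_gmatroid.
Qed.
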